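(* Let $a,b\ge1$, let $T$ be an additive standard tableau of rectangular shape $a\times b$, and let $\lambda$ be a strictly decreasing partition of length $ab$ or $ab-1$. For partitions $\alpha,\beta,\gamma$ of lengths at most $ab$, $a$, $b$ respectively, the $(T,\lambda)$-reduced Kronecker coefficient $g_{T,\lambda}(\alpha,\beta,\gamma)$ is equal to the number of integral points in the polytope $P_{T,\lambda}(\beta-a_T(\alpha),\gamma-b_T(\alpha))$.
   Context: Kronecker coefficients: $g(\lambda,\mu,\nu)=\dim([\lambda]\otimes[\mu]\otimes[\nu])^{S_n}$ for partitions of $n$, with $[\lambda]$ the irreducible complex $S_n$-representation indexed by $\lambda$; $g=0$ if the sizes differ. Partitions are added componentwise. A standard tableau $T$ of shape $a\times b$ is a bijective filling of the boxes $(i,j)$, $1\le i\le a$, $1\le j\le b$, by $1,\dots,ab$, with entries $T(i,j)$ increasing along rows and columns. It is additive if there exist increasing sequences $x_1<\cdots<x_a$ and $y_1<\cdots<y_b$ such that $T(i,j)<T(k,l)\Leftrightarrow x_i+y_j<x_k+y_l$. For a partition $\lambda$ of length at most $ab$ put $a_T(\lambda)_i=\sum_{j=1}^b\lambda_{T(i,j)}$ and $b_T(\lambda)_j=\sum_{i=1}^a\lambda_{T(i,j)}$. The $(T,\lambda)$-reduced Kronecker coefficient $g_{T,\lambda}(\alpha,\beta,\gamma)$ is the value of $g(\alpha+k\lambda,\beta+ka_T(\lambda),\gamma+kb_T(\lambda))$ for $k$ very large (this sequence is eventually constant). Let $e_1,\dots,e_a$ and $f_1,\dots,f_b$ be the standard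 bases of $\mathbb{Z}^a$ and $\mathbb{Z}^b$. Let $(u_i,v_i)$, $1\le i\le M=(a-1)(b-1)(ab+a+b)/2$, be the list (with multiplicities) of the weights of $gr(N^* )$, i.e. the multiset of the vectors $(e_k-e_i,\,f_l-f_j)$ over all pairs of boxes with $T(i,j)<T(k,l)$, from which one copy of $(e_k-e_i,0)$ for each $i<k$ and one copy of $(0,f_l-f_j)$ for each $j<l$ have been removed. For $(\mu,\nu)\in\mathbb{Z}^a\times\mathbb{Z}^b$, $P_{T,\lambda}(\mu,\nu)$ is the set of $(t_1,\dots,t_M)\in\mathbb{R}^M$ with all $t_i\ge0$ and $\sum_{i=1}^M t_i(u_i,v_i)=(\mu,\nu)$. *)

(* Defs.v *)
From HB Require Import structures.
From mathcomp Require Import all_boot all_order all_algebra.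
From mathcomp Require Import all_fingroup all_solvable all_field all_character.
From mathcomp Require Import zify.
From mathcomp Require Import boolp classical_sets functions cardinality reals.

Set Implicit Arguments.
Unset Strict Implicit.
Unset Printing Implicit Defensive.

Import Order.TTheory GRing.Theory Num.Theory.
Local Open Scope ring_scope.

(** * Partitions *)

(* The length of a partition is its size as a sequence. The operations below   *)
(* do not renormalize their results; [kron] ignores trailing zeros.            *)
Definition is_part (s : seq nat) : bool := sorted geq s && (0%N \notin s).

Definition part_add (s t : seq nat) : seq nat :=
  mkseq (fun i => (nth 0 s i + nth 0 t i)%N) (maxn (size s) (size t)).

Definition part_scale (k : nat) (s : seq nat) : seq nat := map (muln k) s.

(** * Irreducible representations of the symmetric group *)

(* The Young diagram of la, with |la| = n, is filled row by row with the       *)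
(* points 0, .., n-1 of 'I_n: the point i then lies in row                     *)
(* [reshape_index la i] and column [reshape_offset la i].                      *)
Definition row_stab n (la : seq nat) : {set 'S_n} :=
  [set p : 'S_n | [forall i, reshape_index la (p i) == reshape_index la i]].

Definition col_stab n (la : seq nat) : {set 'S_n} :=
  [set q : 'S_n | [forall i, reshape_offset la (q i) == reshape_offset la i]].

(* The Young symmetrizer, as an element of the group algebra of 'S_n (that is, *)
(* a row vector in the regular representation).                                *)
Definition young_symmetrizer n (la : seq nat) : 'rV[algC]_#|[set: 'S_n]| :=
  \sum_(p in row_stab n la) \sum_(q in col_stab n la)
    (-1) ^+ (q : bool) *: delta_mx 0 (gring_index [set: 'S_n]%G (p * q)%g).

(* MathComp representations act on row vectors on the right, so the Specht     *)
(* module [la] is the right ideal generated by the Young symmetrizer. Complex  *)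
(* representations of finite groups are taken over algC.                       *)
Definition specht n (la : seq nat) :=
  submod_repr (cyclic_mx_module (regular_repr algC [set: 'S_n]%G)
                                (young_symmetrizer n la)).

Definition kron (la mu nu : seq nat) : nat :=
  let n := sumn la in
  if (sumn mu == n) && (sumn nu == n) then
    \rank (rfix_mx (prod_repr (prod_repr (specht n la) (specht n mu))
                              (specht n nu)) [set: 'S_n])
  else 0%N.

(** * Tableaux *)

(* Boxes and entries are numbered from 0, so an entry is the 0-based index of  *)
(* the corresponding part of a partition.                                      *)
Definition standard_tableau a b (T : 'I_a * 'I_b -> 'I_(a * b)) : Prop :=
  [/\ bijective T,
      forall (i : 'I_a) (j l : 'I_b), (j < l)%N -> (T (i, j) < T (i, l))%N &
      forall (i k : 'I_a) (j : 'I_b), (i < k)%N -> (T (i, j) < T (k, j))%N].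

Definition additive_tableau (R : realType) a b
    (T : 'I_a * 'I_b -> 'I_(a * b)) : Prop :=
  exists (x : 'I_a -> R) (y : 'I_b -> R),
    [/\ forall i k : 'I_a, (i < k)%N -> x i < x k,
        forall j l : 'I_b, (j < l)%N -> y j < y l &
        forall (i k : 'I_a) (j l : 'I_b),
          (T (i, j) < T (k, l))%N <-> x i + y j < x k + y l].

Definition aT a b (T : 'I_a * 'I_b -> 'I_(a * b)) (la : seq nat) : seq nat :=
  [seq (\sum_(j < b) nth 0 la (T (i, j)))%N | i <- enum 'I_a].

Definition bT a b (T : 'I_a * 'I_b -> 'I_(a * b)) (la : seq nat) : seq nat :=
  [seq (\sum_(i < a) nth 0 la (T (i, j)))%N | j <- enum 'I_b].

Definition is_reduced_kron a b (T : 'I_a * 'I_b -> 'I_(a * b))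
    (la al be ga : seq nat) (g : nat) : Prop :=
  exists K : nat, forall k : nat, (K <= k)%N ->
    kron (part_add al (part_scale k la))
         (part_add be (part_scale k (aT T la)))
         (part_add ga (part_scale k (bT T la))) = g.

(** * The polytopes *)

Definition vec m (s : seq nat) : 'rV[int]_m := \row_i (nth 0%N s i)%:Z.

Definition box_weights a b (T : 'I_a * 'I_b -> 'I_(a * b)) :
    seq ('rV[int]_a * 'rV[int]_b) :=
  [seq (delta_mx 0 pq.2.1 - delta_mx 0 pq.1.1,
        delta_mx 0 pq.2.2 - delta_mx 0 pq.1.2)
  | pq : ('I_a * 'I_b) * ('I_a * 'I_b) <-
      enum {: ('I_a * 'I_b) * ('I_a * 'I_b)} & (T pq.1 < T pq.2)%N].

Definition row_weights a b : seq ('rV[int]_a * 'rV[int]_b) :=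
  [seq (delta_mx 0 ik.2 - delta_mx 0 ik.1, 0)
  | ik : 'I_a * 'I_a <- enum {: 'I_a * 'I_a} & (ik.1 < ik.2)%N].

Definition col_weights a b : seq ('rV[int]_a * 'rV[int]_b) :=
  [seq (0, delta_mx 0 jl.2 - delta_mx 0 jl.1)
  | jl : 'I_b * 'I_b <- enum {: 'I_b * 'I_b} & (jl.1 < jl.2)%N].

(* Multiset difference: [rem] deletes a single occurrence. *)
Definition weights a b (T : 'I_a * 'I_b -> 'I_(a * b)) :
    seq ('rV[int]_a * 'rV[int]_b) :=
  foldr (fun w s => rem w s) (box_weights T) (row_weights a b ++ col_weights a b).

Lemma perm_foldr_rem (E : eqType) (r s : seq E) :
  uniq r -> {subset r <= s} -> perm_eq s (r ++ foldr (fun w u => rem w u) s r).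
Proof.
elim: r => //= x r IH /andP[xr ur] rs.
have {}IH := IH ur (fun y yr => rs y (mem_behead (yr : y \in behead (x :: r)))).
apply: (perm_trans IH); rewrite -cat_cons -cat1s -catA perm_sym perm_catCA /=.
rewrite perm_cat2l perm_sym; apply: perm_to_rem.
have := rs x (mem_head _ _); rewrite (perm_mem IH) mem_cat => /orP[|//].
by rewrite (negPf xr).
Qed.

Lemma delta_subI m (i k i' k' : 'I_m) : (i < k)%N -> (i' < k')%N ->
  delta_mx 0 k - delta_mx 0 i = delta_mx 0 k' - delta_mx 0 i' :> 'rV[int]_m ->
  (i, k) = (i', k').
Proof.
move=> ik ik' /matrixP E; have := E 0 k; have := E 0 i; rewrite !mxE !eqxx /=.
have nki : k == i = false by apply/eqP => e; rewrite e ltnn in ik.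
rewrite nki (eq_sym i k) nki.
have ne : k' == i' = false by apply/eqP => e; rewrite e ltnn in ik'.
by move: (eqVneq k k') (eqVneq i k') (eqVneq i i') (eqVneq k i') =>
   [->|_] [e2|_] [e3|_] [e4|_] //; subst; rewrite ?eqxx ?ltnn // in ik ik' ne *.
Qed.

Lemma uniq_row_col a b : uniq (row_weights a b ++ col_weights a b).
Proof.
rewrite cat_uniq; apply/and3P; split.
- rewrite map_inj_in_uniq ?filter_uniq -?enumT ?enum_uniq // => -[i k] [i' k'].
  by rewrite !mem_filter /= => /andP[H _] /andP[H' _] [] /(delta_subI H H').
- apply/hasPn => _ /mapP[[i k] + ->]; rewrite mem_filter => /andP[/= ik _].
  apply/mapP => -[[i' k'] _ [_ /matrixP/(_ 0 k)]]; rewrite !mxE !eqxx /=.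
  by have -> : k == i = false by apply/eqP => e; rewrite e ltnn in ik.
- rewrite map_inj_in_uniq ?filter_uniq -?enumT ?enum_uniq // => -[i k] [i' k'].
  by rewrite !mem_filter /= => /andP[H _] /andP[H' _] [] /(delta_subI H H').
Qed.

Lemma perm_weights a b (T : 'I_a * 'I_b -> 'I_(a * b)) :
  (0 < a)%N -> (0 < b)%N -> standard_tableau T ->
  perm_eq (box_weights T) ((row_weights a b ++ col_weights a b) ++ weights T).
Proof.
move=> a0 b0 [_ Tr Tc]; apply: perm_foldr_rem; first exact: uniq_row_col.
move=> w; rewrite mem_cat => /orP[] /mapP[[i k] + ->];
  rewrite mem_filter => /andP[/= ik _]; apply/mapP.
- exists ((i, Ordinal b0), (k, Ordinal b0)); last by rewrite /= subrr.
  by rewrite mem_filter mem_enum /= Tc.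
- exists ((Ordinal a0, i), (Ordinal a0, k)); last by rewrite /= subrr.
  by rewrite mem_filter mem_enum /= Tr.
Qed.

Lemma size_lt (X : finType) n (f : X -> 'I_n) : bijective f ->
  size [seq pq : X * X <- enum {: X * X} | (f pq.1 < f pq.2)%N] = 'C(n, 2).
Proof.
move=> bf; rewrite size_filter -sum1_count big_enum_cond /=.
rewrite -(pair_big_dep xpredT (fun p q => f p < f q)%N (fun _ _ => 1%N)) /=.
rewrite -bin2_sum big_mkord.
rewrite (exchange_big_dep xpredT) //=.
rewrite [RHS](reindex f) /=; last exact: onW_bij.
apply: eq_bigr => q _; rewrite sum1_card.
have := bij_inj bf => fi; rewrite -(fintype.card_image fi).
have wi : injective (widen_ord (ltnW (ltn_ord (f q))))
  by move=> u v /(congr1 val) /= /val_inj.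
rewrite -[RHS]card_ord -[RHS](card_imset _ wi).
apply: eq_card => i; apply/fintype.imageP/imsetP => [[p pq ->]|[j _ ->]].
  by exists (Ordinal (pq : f p < f q)%N) => //; apply: val_inj.
case: bf => g gK fK; exists (g (widen_ord (ltnW (ltn_ord (f q))) j)); rewrite ?fK //.
by change (f (g (widen_ord (ltnW (ltn_ord (f q))) j)) < f q)%N; rewrite fK; exact: ltn_ord j.
Qed.

Lemma size_weights a b (T : 'I_a * 'I_b -> 'I_(a * b)) :
  (0 < a)%N -> (0 < b)%N -> standard_tableau T ->
  size (weights T) = ((a.-1 * b.-1 * (a * b + a + b)) %/ 2)%N.
Proof.
move=> a0 b0 sT; have /perm_size := perm_weights a0 b0 sT; case: sT => bT _ _.
rewrite !size_cat !size_map (size_lt bT).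
rewrite (@size_lt _ _ (@id 'I_a)) ?(@size_lt _ _ (@id 'I_b)); try by exists id.
have H n : (n.+1 * n = 2 * 'C(n.+1, 2))%N.
  by rewrite bin2 /= -[LHS]odd_double_half oddM /= andNb -mul2n.
case: a a0 T bT => // a _ T bT; case: b b0 T bT => // b _ T bT /=.
have := H a; have := H b; have := H (a.+1 * b + a)%N.
have -> : ((a.+1 * b + a).+1 = a.+1 * b.+1)%N by nia.
set x := 'C(_, 2); set y := 'C(_, 2); set z := 'C(_, 2) => h1 h2 h3 h4.
have E : (a * b * (a.+1 * b.+1 + a.+1 + b.+1) = 2 * size (weights T))%N by nia.
by rewrite E mulKn.
Qed.

Definition polytope (R : realType) a b (T : 'I_a * 'I_b -> 'I_(a * b))
    (mu : 'rV[int]_a) (nu : 'rV[int]_b) : set 'rV[R]_(size (weights T)) :=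
  [set t : 'rV[R]_(size (weights T)) |
    [/\ forall i, 0 <= t 0 i,
        \sum_(i < size (weights T))
          t 0 i *: map_mx intr (nth 0 (weights T) i).1 = map_mx intr mu &
        \sum_(i < size (weights T))
          t 0 i *: map_mx intr (nth 0 (weights T) i).2 = map_mx intr nu]]%classic.
Arguments polytope R {a b} T mu nu.

Definition integral_points (R : realType) m (P : set 'rV[R]_m) : set 'rV[R]_m :=
  [set t : 'rV[R]_m | P t /\ forall i, t 0 i \is a Num.int]%classic.

(* Main.v *)
Require Import Defs.
From HB Require Import structures.
From mathcomp Require Import all_boot all_order all_algebra.
From mathcomp Require Import all_fingroup all_field all_character.
From mathcomp Require Import zify ring lra.
From mathcomp Require mpoly.

Set Implicit Arguments.
Unset Strict Implicit.
Unset Printing Implicit Defensive.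

Import Order.TTheory GRing.Theory Num.Theory.
Local Open Scope ring_scope.

(** Let [psi_M] be the permutation character of S_n on words of content [M], and
    let [phi_la] be the alternating sum of the [psi_(la + rho - s rho)].  The
    Jacobi-Trudi identity (for polynomials in any commuting elements [x_i]),
      det (x_i ^ (la_j + rho_j)) = det (h_(la_j + rho_j - rho_r)) * det (x_i ^ rho_j),
    shows that [phi_la] has norm 1.  If [c] is the Young symmetrizer, with
    [c * c = h c], von Neumann's lemma shows that the character of [c A] has norm 1
    and inner product 1 with [phi_la]; hence the two are equal.

    Consequently [kron la mu nu] is obtained from the coefficients of the Schur
    function [s_la] at the [a * b] elements [x_i y_j] by applying the product of the
    operators [1 - shift by w], over the row and column weights [w].  Applying
    further the operators of the weights of [T] gives the product over all box
    weights, that is the Weyl denominator of GL_(ab), so that the result is an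
    alternating sum of ab! delta functions.  Additivity of [T] provides a linear
    functional which is positive on all weights: it allows one to invert the
    operators, expressing [kron] as an alternating sum of numbers of integral
    points, and, by the rearrangement inequality, it excludes all the terms but
    that of the identity when [k] is large. *)

(** * Contents of words *)

Definition content n (I : finType) (f : {ffun 'I_n -> I}) (i : I) : nat :=
  #|[set x | f x == i]|.

Definition pull n (I : finType) (f : {ffun 'I_n -> I}) (g : 'S_n) :
  {ffun 'I_n -> I} := [ffun x => f (g x)].

Lemma content_pull n (I : finType) (f : {ffun 'I_n -> I}) g :
  content (pull f g) =1 content f.
Proof.
move=> i; rewrite /content -[RHS](card_imset _ (@perm_inj _ (g^-1)%g)).
apply: eq_card => x; rewrite inE ffunE; apply/idP/imsetP => [fx|[y]].
  by exists (g x); rewrite ?inE // permK.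
by rewrite inE => fy ->; rewrite permKV.
Qed.

Lemma content_sum n (I : finType) (f : {ffun 'I_n -> I}) :
  (\sum_i content f i)%N = n.
Proof.
rewrite -[RHS]card_ord -sum1_card (partition_big f xpredT) //=.
by apply: eq_bigr => i _; rewrite sum1_card; apply: eq_card => x; rewrite inE.
Qed.

Lemma content_le n (I : finType) (f : {ffun 'I_n -> I}) i : (content f i <= n)%N.
Proof. by rewrite -[leqRHS]card_ord max_card. Qed.

Lemma pullM n (I : finType) (f : {ffun 'I_n -> I}) g h :
  pull f (g * h)%g = pull (pull f h) g.
Proof. by apply/ffunP => x; rewrite !ffunE permM. Qed.

(** Words with equal contents are rearrangements of each other as tuples of letters, so they form a
    single orbit under [pull]. *)
Lemma content_pullP n (I : finType) (f f' : {ffun 'I_n -> I}) :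
  content f =1 content f' -> exists g, f' = pull f g.
Proof.
move=> ff'.
have cE (h : {ffun 'I_n -> I}) i : count_mem i [tuple h x | x < n] = content h i.
  rewrite /content count_map -sum1_card -sum1_count big_enum_cond /=.
  by apply: eq_bigl => x; rewrite inE.
have pE : perm_eq [tuple f' x | x < n] [tuple f x | x < n].
  by apply/allP => i _ /=; rewrite !cE ff'.
have /tuple_permP[p Hp] := pE.
exists p; apply/ffunP => x; rewrite ffunE.
have /(congr1 (fun t => tnth t x)) := val_inj Hp.
by rewrite !tnth_mktuple.
Qed.

Lemma content_exists n (I : finType) (M : I -> nat) :
  (\sum_i M i)%N = n -> exists f : {ffun 'I_n -> I}, content f =1 M.
Proof.
move=> Mn; pose s := flatten [seq nseq (M i) i | i <- enum I].
have sz : size s == n.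
  rewrite size_flatten sumnE big_map big_map -Mn big_enum /=.
  by apply/eqP/eq_bigr => i _; rewrite size_nseq.
exists [ffun x => tnth (Tuple sz) x] => i.
have <- : count_mem i s = M i.
  rewrite count_flatten sumnE 2!big_map. rewrite big_enum /= (bigD1 i) //= big1 ?addn0.
    by rewrite count_nseq /= eqxx mul1n.
  by move=> j ji; rewrite count_nseq /= (negPf ji).
have sE : s = [tuple tnth (Tuple sz) x | x < n] :> seq I.
  rewrite -[LHS]/(tval (Tuple sz)); congr tval.
  by apply: eq_from_tnth => x; rewrite tnth_mktuple.
rewrite [in RHS]sE /content count_map -sum1_card -sum1_count big_enum_cond /=.
by apply: eq_bigl => x; rewrite inE ffunE.
Qed.

(** A finite type of contents, so that one can sum over them; [inord] truncates nothing when
    [n <= K]. *)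
Definition bcontent K n (I : finType) (f : {ffun 'I_n -> I}) : {ffun I -> 'I_K.+1} :=
  [ffun i => inord (content f i)].

Lemma bcontentE K n (I : finType) (f : {ffun 'I_n -> I}) i : (n <= K)%N ->
  bcontent K f i = content f i :> nat.
Proof. by move=> nK; rewrite ffunE inordK // ltnS (leq_trans (content_le f i)). Qed.

(** Orbit-stabilizer: [g |-> pull f g] reaches every word with the content of [f], and its fibre
    over [f'] is a coset of the stabilizer of [f']. *)
Lemma sum_stab n (I : finType) (f : {ffun 'I_n -> I}) :
  (\sum_(f' | [forall i, content f' i == content f i])
     #|[set g : 'S_n | pull f' g == f']|)%N = n`!.
Proof.
have <- : #|'S_n| = n`! by rewrite card_Sn.
rewrite -sum1_card.
rewrite (partition_big (pull f) (fun f' => [forall i, content f' i == content f i])) /=; last first.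
  by move=> g _; apply/forallP => i; rewrite content_pull.
apply: eq_bigr => f' /forallP ff'; rewrite sum1_card.
have [h hE] : exists h, f' = pull f h.
  by apply: content_pullP => i; rewrite (eqP (ff' i)).
rewrite -[LHS](card_imset _ (@mulIg _ h)); apply: eq_card => g.
apply/imsetP/idP => [[k]|].
  rewrite inE => /eqP E ->.
  by rewrite -[_ \in _]/(pull f (k * h)%g == f') pullM -hE E.
rewrite -[_ \in _]/(pull f g == f') => /eqP E.
exists (g * h^-1)%g; last by rewrite mulgKV.
by rewrite inE {1}hE -pullM mulgKV E.
Qed.

(** Burnside's count: after exchanging the sums, the words of each content form one orbit, which
    contributes [n!] by [sum_stab]. *)
Lemma orbit_count K n (I : finType) (Q : pred {ffun I -> 'I_K.+1}) : (n <= K)%N ->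
  (\sum_(g : 'S_n) #|[set f : {ffun 'I_n -> I} | Q (bcontent K f) & pull f g == f]|)%N
  = (n`! * #|[set M : {ffun I -> 'I_K.+1} | Q M & (\sum_i M i)%N == n]|)%N.
Proof.
move=> nK.
transitivity (\sum_(f : {ffun 'I_n -> I} | Q (bcontent K f))
   #|[set g : 'S_n | pull f g == f]|)%N.
  under eq_bigr do rewrite -sum1dep_card.
  rewrite (exchange_big_dep (fun f => Q (bcontent K f))) /=; last by move=> g f _ /andP[].
  by apply: eq_bigr => f Qf; rewrite -sum1dep_card; apply: eq_bigl => g; rewrite Qf.
rewrite (partition_big (@bcontent K n I) (fun M => Q M && ((\sum_i M i)%N == n))) /=; last first.
  move=> f Qf; rewrite Qf /=; apply/eqP; rewrite -[RHS](content_sum f).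
  by apply: eq_bigr => i _; rewrite bcontentE.
rewrite mulnC -sum1dep_card big_distrl /=.
apply: eq_bigr => M /andP[QM /eqP sM]; rewrite mul1n.
have [f fM] := content_exists sM.
rewrite -(sum_stab f); apply: eq_bigl => f'; apply/andP/forallP => [[_ /eqP E] i|ff'].
  by rewrite fM -E bcontentE.
have -> : bcontent K f' = M by apply/ffunP => j; apply: val_inj; rewrite /= bcontentE // (eqP (ff' j)) fM.
by rewrite QM eqxx.
Qed.

(** * The Jacobi-Trudi identity *)

(* The complete homogeneous symmetric polynomial [h_k], but only for [k <= K]:
   exponents are truncated at [K]. *)
Definition hsym (R : comNzRingType) N K (x : 'I_N -> R) (k : nat) : R :=
  \sum_(M : {ffun 'I_N -> 'I_K.+1} | (\sum_i M i)%N == k) \prod_i x i ^+ M i.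

(* [h_(m - r)], with the convention [h_k = 0] for [k < 0]. *)
Definition hsub (R : comNzRingType) N K (x : 'I_N -> R) (m r : nat) : R :=
  if (r <= m)%N then hsym K x (m - r) else 0.

Section JacobiTrudi.
Variables (R : comNzRingType) (N K : nat) (x : 'I_N -> R).

(** [geom y] is the series of [1 / (1 - y X)] cut after degree [K]. Up to that degree, multiplying
    [hgen] by [egen i] cancels every factor but that of [x i]. *)
Let geom (y : R) : {poly R} := \sum_(t < K.+1) y ^+ t *: 'X^t.
Let hgen : {poly R} := \prod_i geom (x i).
Let egen i : {poly R} := \prod_(l | l != i) (1 - x l *: 'X).

Lemma coef_hgen k : hgen`_k = hsym K x k.
Proof.
rewrite /hgen bigA_distr_bigA coef_sum /hsym [RHS]big_mkcond /=.
apply: eq_bigr => M _.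
rewrite (eq_bigr (fun i => (x i ^+ M i)%:P * 'X^(M i))); last by move=> i _; rewrite mul_polyC.
rewrite big_split /= -rmorph_prod /= -expr_sum coefCM coefXn eq_sym.
by case: eqP => _; rewrite ?mulr1 ?mulr0.
Qed.

Lemma geomM (y : R) : geom y * (1 - y *: 'X) = 1 - y ^+ K.+1 *: 'X^(K.+1).
Proof.
rewrite -!mul_polyC polyC_exp -exprMn -[in RHS](expr1n _ K.+1) subrXX.
rewrite mulrC; congr (_ * _); apply: eq_bigr => t _.
by rewrite expr1n mul1r exprMn -polyC_exp mul_polyC.
Qed.

Lemma hgen_egen i m : (m <= K)%N -> (hgen * egen i)`_m = x i ^+ m.
Proof.
move=> mK; rewrite /hgen (bigD1 i) //= -mulrA -big_split /=.
under eq_bigr do rewrite geomM.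
(* The truncation errors are multiples of [X^(K+1)], invisible at degree [m <= K]. *)
have [q ->] : exists q : {poly R},
    \prod_(l | l != i) (1 - x l ^+ K.+1 *: 'X^(K.+1)) = 1 + q * 'X^(K.+1).
  apply: (big_ind (fun p : {poly R} => exists q, p = 1 + q * 'X^(K.+1))).
  - by exists 0; rewrite mul0r addr0.
  - move=> _ _ [q ->] [q' ->]; exists (q + q' + q * q' * 'X^(K.+1)).
    by ring.
  - by move=> l _; exists (- (x l ^+ K.+1)%:P); rewrite mulNr mul_polyC.
rewrite mulrDr mulr1 coefD mulrA coefMXn ltnS mK addr0 coef_sum.
have mK' : (m < K.+1)%N by [].
rewrite (bigD1 (Ordinal mK')) //= coefZ coefXn eqxx mulr1 big1 ?addr0 // => t tm.
rewrite coefZ coefXn; case: eqP => [mt|]; last by rewrite mulr0.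
by case/eqP: tm; apply: val_inj.
Qed.

Lemma size_egen i : (size (egen i) <= N)%N.
Proof.
apply: leq_trans (size_prod_leq _ _) _.
have sl l : (size (1 - x l *: 'X : {poly R})%R <= 2)%N.
  apply: (leq_trans (size_polyD _ _)); rewrite geq_max size_poly1 /= size_polyN.
  by apply: leq_trans (size_scale_leq _ _) _; rewrite size_polyX.
have c : #|[pred l | l != i]| = N.-1.
  by have := cardC1 i; rewrite card_ord.
have : (\sum_(l | l != i) size (1 - x l *: 'X : {poly R})%R <= \sum_(l | l != i) 2)%N.
  by apply: leq_sum => l _; apply: sl.
rewrite sum_nat_const c; have := ltn_ord i; lia.
Qed.

Lemma hsym0 : hsym K x 0 = 1.
Proof.
rewrite /hsym (bigD1 [ffun => ord0]) /=; last by rewrite big1 // => i _; rewrite ffunE.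
rewrite big1 => [|i _]; last by rewrite ffunE expr0.
rewrite big1 ?addr0 // => M /andP[]; rewrite sum_nat_eq0 => /forallP M0 /eqP[].
by apply/ffunP => i; apply: val_inj; rewrite ffunE; apply/eqP: (M0 i).
Qed.

(** Read as a convolution, [hgen_egen] factors the matrix of powers as the matrix of the [h] times a
    matrix [E] that does not depend on the exponents. The exponents [rho] then identify [\det E]. *)
Lemma jacobi_trudi (m : 'I_N -> nat) : (N <= K)%N -> (forall j, m j <= K)%N ->
  \det (\matrix_(j, i) x i ^+ m j) =
  \det (\matrix_(j, r) hsub K x (m j) (rev_ord r)) *
  \det (\matrix_(j, i) x i ^+ rev_ord j).
Proof.
move=> NK mK; pose E := \matrix_(r < N, i < N) (egen i)`_(rev_ord r).
have key (m' : 'I_N -> nat) : (forall j, m' j <= K)%N ->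
    \matrix_(j, i) x i ^+ m' j = (\matrix_(j, r) hsub K x (m' j) (rev_ord r)) *m E.
  move=> m'K; apply/matrixP => j i; rewrite !mxE -hgen_egen // coefMr.
  transitivity (\sum_(r < N) hsub K x (m' j) r * (egen i)`_r); last first.
    by rewrite (reindex_inj rev_ord_inj); apply: eq_bigr => r _; rewrite !mxE.
  rewrite -(big_mkord xpredT (fun r => hgen`_(m' j - r) * (egen i)`_r)).
  rewrite -(big_mkord xpredT (fun r => hsub K x (m' j) r * (egen i)`_r)).
  (* The convolution stops at [m' j] and the matrix product at [N]. Both extend to a common range:
     [hsub] vanishes beyond the former, the coefficients of [egen i] from the latter on. *)
  rewrite (big_nat_widen _ _ ((m' j).+1 + N)) ?leq_addr //.
  rewrite [RHS](big_nat_widen _ _ ((m' j).+1 + N)) ?leq_addl //.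
  rewrite big_mkcond [RHS]big_mkcond /=; apply: eq_bigr => r _.
  rewrite /hsub ltnS coef_hgen; case: ltnP => [rN|Nr]; first by case: leqP; rewrite ?mul0r.
  by rewrite [(egen i)`_r]nth_default ?mulr0 ?if_same // (leq_trans (size_egen i)).
rewrite key // det_mulmx; congr (_ * _).
(* For the exponents [rev_ord], the matrix of the [h] is unitriangular, so [\det E] is the
   Vandermonde determinant. *)
rewrite key ?det_mulmx; last by move=> j; apply: leq_trans NK; rewrite ltnW ?ltn_ord.
rewrite -[LHS]mul1r; congr (_ * _).
rewrite -det_tr det_trig; last first.
  apply/is_trig_mxP => i j ij; rewrite !mxE /hsub /= leqNgt ifN // negbK.
  by have := ltn_ord j; lia.
by rewrite big1 // => i _; rewrite !mxE /hsub leqnn subnn hsym0.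
Qed.
Lemma det_rev_Vandermonde :
  \det (\matrix_(j, i) x i ^+ rev_ord j) =
  \prod_(p : 'I_N * 'I_N | (p.1 < p.2)%N) (x p.1 - x p.2).
Proof.
have := det_Vandermonde (\row_i x (rev_ord i)).
pose s : 'S_N := perm (@rev_ord_inj N).
have -> : Vandermonde N (\row_i x (rev_ord i)) =
    row_perm s (col_perm s (\matrix_(j, i) x i ^+ rev_ord j)).
  by apply/matrixP => i j; rewrite !mxE !permE rev_ordK.
rewrite row_permE col_permE !det_mulmx !det_perm odd_permV mulrC -mulrA -signr_addb addbb mulr1.
move=> ->; rewrite (pair_big_dep xpredT (fun i j : 'I_N => (i < j)%N)) /=.
pose f (p : 'I_N * 'I_N) := (rev_ord p.2, rev_ord p.1).
have fK : cancel f f by case=> i j; rewrite /f /= !rev_ordK.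
rewrite (reindex_inj (can_inj fK)) /=; apply: eq_big => [[i j]|[i j] _] /=.
  by have := ltn_ord i; have := ltn_ord j; lia.
by rewrite !mxE !rev_ordK.
Qed.
End JacobiTrudi.

(** * Coefficients and shift operators *)

(** On coefficient functions, this is multiplication by [1 - X^w]. *)
Definition shift_diff (V : zmodType) (w : V) (c : V -> int) (v : V) : int :=
  c v - c (v - w).

Definition shift_prod (V : zmodType) (W : seq V) (c : V -> int) : V -> int :=
  foldr (@shift_diff V) c W.

Lemma shift_prod_cat (V : zmodType) (W W' : seq V) c :
  shift_prod (W ++ W') c = shift_prod W (shift_prod W' c).
Proof. by rewrite /shift_prod foldr_cat. Qed.

Lemma eq_shift_prod (V : zmodType) (W : seq V) c c' :
  c =1 c' -> shift_prod W c =1 shift_prod W c'.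
Proof.
by elim: W => //= w W IH cc' v; rewrite /shift_diff !IH.
Qed.

Lemma shift_prod_rot1 (V : zmodType) (w : V) W c :
  shift_prod (W ++ [:: w]) c =1 shift_prod (w :: W) c.
Proof.
elim: W => //= w' W IH v; rewrite /shift_diff !IH /= /shift_diff.
by rewrite [v - w' - w]addrAC; ring.
Qed.

Lemma shift_prod_perm (V : zmodType) (W W' : seq V) c :
  perm_eq W W' -> shift_prod W c =1 shift_prod W' c.
Proof.
move=> WW'; elim: W W' c WW' => [|w W IH] W' c WW'.
  by rewrite perm_sym in WW'; rewrite (perm_nilP WW').
have wW' : w \in W' by rewrite -(perm_mem WW') mem_head.
case/splitPr: wW' WW' => W1 W2 WW' v.
have {}WW' : perm_eq W (W1 ++ W2).
  by rewrite -(perm_cons w) (perm_trans WW') // perm_catC /= perm_cons perm_catC.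
rewrite -[w :: W2]cat1s catA shift_prod_cat shift_prod_rot1.
by rewrite /= /shift_diff -!shift_prod_cat !(IH _ _ WW').
Qed.

Section Polynomials.
Import mpoly.
Local Open Scope ring_scope.
Variable d : nat.
Implicit Types (P : {mpoly int[d]}) (u v : 'rV[int]_d).

Definition mvec (m : 'X_{1..d}) : 'rV[int]_d := \row_i (m i)%:Z.

(** Exponents range over the whole group of integer vectors, so that shifts act on the coefficient
    function. *)
Definition laurent_coef v P : int :=
  if [forall i, 0 <= v 0 i] then P@_[multinom absz (v 0%R i) | i < d] else 0.

Lemma mvecD m m' : mvec (m + m')%MM = mvec m + mvec m'.
Proof. by apply/rowP => i; rewrite !mxE mnmDE PoszD. Qed.

Lemma mvec0 : mvec 0%MM = 0.
Proof. by apply/rowP => i; rewrite !mxE mnm0E. Qed.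

Lemma mvec_sum (I : Type) (r : seq I) (Q : pred I) F :
  mvec (\big[+%MM/0%MM]_(i <- r | Q i) F i) = \sum_(i <- r | Q i) mvec (F i).
Proof. exact: (big_morph _ mvecD mvec0). Qed.

Lemma mvecMn m k : mvec (m *+ k)%MM = mvec m *+ k.
Proof.
by elim: k => [|k IH]; rewrite ?mulm0n ?mvec0 ?mulr0n // mulmS mvecD IH mulrS.
Qed.

Lemma laurent_coef_is_additive v : zmod_morphism (laurent_coef v).
Proof. by move=> P Q; rewrite /laurent_coef; case: ifP; rewrite ?subr0 // raddfB. Qed.

HB.instance Definition _ v :=
  GRing.isZmodMorphism.Build {mpoly int[d]} int (laurent_coef v)
    (laurent_coef_is_additive v).

Lemma laurent_coefZ v (a : int) P : laurent_coef v (a *: P) = a * laurent_coef v P.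
Proof. by rewrite /laurent_coef; case: ifP => _; rewrite ?mulr0 // mcoeffZ. Qed.

Lemma laurent_coefX m v : laurent_coef v 'X_[m] = (mvec m == v)%:R.
Proof.
rewrite /laurent_coef mcoeffX; case: ifP => [/forallP v0|nv].
  congr (nat_of_bool _)%:R; apply/eqP/eqP => [->|<-].
    by apply/rowP => i; rewrite mxE mnmE gez0_abs.
  by apply/mnmP => i; rewrite mnmE mxE.
by case: eqP => // mv; case/negP: nv; apply/forallP => i; rewrite -mv mxE.
Qed.
Lemma laurent_coefXM m P v :
  laurent_coef v ('X_[m] * P) = laurent_coef (v - mvec m) P.
Proof.
rewrite (mpolyE P) mulr_sumr !raddf_sum /=; apply: eq_bigr => k _.
rewrite -scalerAr !laurent_coefZ -mpolyXD !laurent_coefX mvecD.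
by rewrite [mvec m + _]addrC eq_sym -subr_eq eq_sym.
Qed.

(** Each operator multiplies by [1 - X^(p.2 - p.1)]. Clearing the denominator [X^(p.1)] keeps the
    product polynomial and moves the point of evaluation by [mvec p.1]. *)
Lemma shift_prod_laurent (W : seq ('X_{1..d} * 'X_{1..d})) P v :
  shift_prod [seq mvec p.2 - mvec p.1 | p <- W] (fun u => laurent_coef u P) v =
  laurent_coef (v + \sum_(p <- W) mvec p.1) (\prod_(p <- W) ('X_[p.1] - 'X_[p.2]) * P).
Proof.
elim: W v => [|p W IH] v /=; first by rewrite !big_nil addr0 mul1r.
rewrite /shift_diff !IH !big_cons -mulrA mulrBl [RHS]raddfB /= !laurent_coefXM.
move: (\sum_(j <- W) mvec j.1) (\prod_(j <- W) _) => y Q.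
by congr (laurent_coef _ _ - laurent_coef _ _); apply/rowP => i; rewrite !mxE; ring.
Qed.

Lemma laurent_coef_finite P :
  exists s : seq 'rV[int]_d, forall v, v \notin s -> laurent_coef v P = 0.
Proof.
exists [seq mvec m | m <- msupp P] => v vP.
rewrite (mpolyE P) raddf_sum big_seq big1 // => m mP /=.
rewrite laurent_coefZ laurent_coefX; case: eqP => [mv|]; last by rewrite mulr0.
by case/mapP: vP; exists m.
Qed.
End Polynomials.

(** * Permutation characters *)

(** Contents are compared in the integers: a negative entry of [M] gives the zero function, in
    accordance with [h_k = 0] for [k < 0]. *)
Definition psi n (I : finType) (M : I -> int) (g : 'S_n) : algC :=
  #|[set f : {ffun 'I_n -> I} | [forall i, (content f i)%:Z == M i] & pull f g == f]|%:R.

(** The character of the weight [u] part of the [n]-th tensor power of a space whose basis vectors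
    have weights [e i]. *)
Definition wpsi n (I : finType) (V : zmodType) (e : I -> V) (u : V) (g : 'S_n) : algC :=
  #|[set f : {ffun 'I_n -> I} | \sum_x e (f x) == u & pull f g == f]|%:R.

(** For [m = la + rho], this is the expanded Jacobi-Trudi determinant with every product of [h]'s
    replaced by a permutation character. *)
Definition phi n N (m : 'I_N -> nat) (g : 'S_n) : algC :=
  \sum_(s : 'S_N) (-1) ^+ s * psi (fun i => (m i)%:Z - (rev_ord (s i))%:Z) g.

Lemma sum_content n (I : finType) (V : zmodType) (e : I -> V) (f : {ffun 'I_n -> I}) :
  \sum_x e (f x) = \sum_i e i *+ content f i.
Proof.
rewrite (partition_big f xpredT) //=; apply: eq_bigr => i _.
rewrite (eq_bigr (fun=> e i)) => [|x /eqP-> //].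
by rewrite sumr_const; congr (_ *+ _); apply: eq_card => x; rewrite inE.
Qed.

Lemma psi_wpsi n (J I : finType) (M : J -> int) (V : zmodType) (e : I -> V) u (g : 'S_n) :
  psi M g * wpsi e u g =
  #|[set F : {ffun 'I_n -> J * I} |
      [forall j, (content [ffun x => (F x).1] j)%:Z == M j]
      && (\sum_x e (F x).2 == u) & pull F g == F]|%:R.
Proof.
rewrite -natrM -cardsX; congr _%:R.
pose h (p : {ffun 'I_n -> J} * {ffun 'I_n -> I}) := [ffun x => (p.1 x, p.2 x)].
have hI : injective h.
  move=> [f1 f2] [f1' f2'] /ffunP E; congr (_, _); apply/ffunP => x;
  by have := E x; rewrite !ffunE => -[].
rewrite -(card_imset _ hI); apply: eq_card => F; apply/imsetP/idP => [[[f1 f2]]|].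
  rewrite !inE /= => /andP[/andP[M1 /eqP p1] /andP[M2 /eqP p2]] ->.
  have -> : [ffun x => (h (f1, f2) x).1] = f1 by apply/ffunP => x; rewrite !ffunE.
  rewrite M1; have -> : \sum_x e (h (f1, f2) x).2 = \sum_x e (f2 x).
    by apply: eq_bigr => x _; rewrite ffunE.
  rewrite M2 /=; apply/eqP/ffunP => x; rewrite !ffunE /=.
  by move/ffunP/(_ x): p1; move/ffunP/(_ x): p2; rewrite !ffunE => -> ->.
rewrite inE => /andP[/andP[M1 M2] /eqP/ffunP pF].
exists ([ffun x => (F x).1], [ffun x => (F x).2]); last first.
  by apply/ffunP => x; rewrite !ffunE /=; case: (F x).
rewrite !inE /= M1 (eq_bigr (fun x => e (F x).2)) ?M2 => [|x _]; last by rewrite ffunE.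
by apply/andP; split; apply/eqP/ffunP => x; have := pF x; rewrite !ffunE => ->.
Qed.

Lemma psi_neg n (I : finType) (M : I -> int) i (g : 'S_n) : M i < 0 -> psi M g = 0.
Proof.
move=> Mi; rewrite /psi (_ : [set _ | _ & _] = set0) ?cards0 //.
by apply/setP => f; rewrite !inE; apply/negP => /andP[/forallP/(_ i)]; lia.
Qed.

Lemma content_fst n (J I : finType) (F : {ffun 'I_n -> J * I}) j :
  content [ffun x => (F x).1] j = (\sum_i content F (j, i))%N.
Proof.
rewrite /content -sum1_card (partition_big (fun x => (F x).2) xpredT) //=.
apply: eq_bigr => i _; rewrite sum1_card; apply: eq_card => x.
by rewrite !inE unfold_in /= inE ffunE.
Qed.

(** A pair of words fixed by [g] is a fixed word over [J * I]; its orbits are the nonnegative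
    integer matrices with row sums [M] and total weight [u]. *)
Lemma sum_psi_wpsi n (J I : finType) (M : J -> int) (V : zmodType) (e : I -> V) u K :
  (n <= K)%N ->
  \sum_(g : 'S_n) psi M g * wpsi e u g =
  (n`! * #|[set M' : {ffun J * I -> 'I_K.+1} |
     [forall j, (\sum_i M' (j, i))%N%:Z == M j] && (\sum_p e p.2 *+ M' p == u)
     & (\sum_p M' p)%N == n]|)%:R.
Proof.
move=> nK; rewrite -orbit_count // natr_sum; apply: eq_bigr => g _.
rewrite psi_wpsi; congr _%:R; apply: eq_card => F; rewrite !inE; congr (_ && _ && _).
  apply: eq_forallb => j; rewrite content_fst; congr (_%:Z == _).
  by apply: eq_bigr => i _; rewrite bcontentE.
rewrite (sum_content (fun p => e p.2)); congr (_ == _).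
by apply: eq_bigr => p _; rewrite bcontentE.
Qed.

Section Polynomials.
Import mpoly.
Local Open Scope ring_scope.
Variables (d N : nat) (e : 'I_N -> 'X_{1..d}).
Let x (i : 'I_N) : {mpoly int[d]} := 'X_[e i].

Lemma prod_hsym (J : finType) K (C : J -> nat) :
  \prod_j hsym K x (C j) =
  \sum_(M : {ffun J * 'I_N -> 'I_K.+1} | [forall j, (\sum_i M (j, i))%N == C j])
     'X_[\big[+%MM/0%MM]_p (e p.2 *+ M p)%MM].
Proof.
rewrite /hsym bigA_distr_big_dep.
pose h (F : {ffun J -> {ffun 'I_N -> 'I_K.+1}}) : {ffun J * 'I_N -> 'I_K.+1} :=
  [ffun p => F p.1 p.2].
pose h' (M : {ffun J * 'I_N -> 'I_K.+1}) := [ffun j => [ffun i => M (j, i)]].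
rewrite (reindex h); last first.
  exists h' => F _; apply/ffunP => j; rewrite !ffunE; last by case: j.
  by apply/ffunP => i; rewrite !ffunE.
apply: eq_big => F.
  apply: eq_forallb => j; rewrite -[_ \in _]/((\sum_i F j i)%N == C j).
  by congr (_ == _); apply: eq_bigr => i _; rewrite ffunE.
move=> _; rewrite -mprodXE pair_bigA /=; apply: eq_bigr => -[j i] _ /=.
by rewrite ffunE mpolyXn.
Qed.

(** Both sides count the same matrices: expanding the product of the [h_(C j)] means choosing, for
    every [j], a row of exponents with sum [C j]. *)
Lemma frobenius_coef n (J : finType) (C : J -> nat) u K :
  (n <= K)%N -> (\sum_j C j)%N = n ->
  \sum_(g : 'S_n) psi (fun j => (C j)%:Z) g * wpsi (fun i => mvec (e i)) u g =
  n`!%:R * (laurent_coef u (\prod_j hsym K x (C j)))%:~R.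
Proof.
move=> nK Cn; rewrite (sum_psi_wpsi _ _ _ nK) natrM prod_hsym raddf_sum /=.
congr (_ * _); rewrite -sum1dep_card natr_sum [RHS]rmorph_sum.
rewrite [RHS](eq_bigr (fun M : {ffun J * 'I_N -> 'I_K.+1} =>
   if \sum_p mvec (e p.2) *+ M p == u then 1%:R else 0)); last first.
  move=> M _; rewrite laurent_coefX mvec_sum.
  under eq_bigr do rewrite mvecMn.
  by case: eqP.
rewrite -big_mkcondr /=; apply: eq_bigl => M.
rewrite andbAC; congr (_ && _); apply/andP/idP => [[]//|H]; split=> //.
rewrite (eq_bigr (fun p => M (p.1, p.2) : nat)) => [|[] //].
rewrite -Cn -(pair_bigA _ (fun j i => M (j, i) : nat)) /=.
by apply/eqP/eq_bigr => j _; apply/eqP; have /forallP/(_ j) := H.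
Qed.

Lemma frobenius_phi n (m : 'I_N -> nat) u K : (n <= K)%N ->
  (\sum_i m i = n + \sum_(i < N) rev_ord i)%N ->
  \sum_(g : 'S_n) phi m g * wpsi (fun i => mvec (e i)) u g =
  n`!%:R * (laurent_coef u (\det (\matrix_(j, r) hsub K x (m j) (rev_ord r))))%:~R.
Proof.
move=> nK mn; rewrite /determinant raddf_sum /= rmorph_sum mulr_sumr.
under eq_bigr do rewrite /phi mulr_suml.
rewrite exchange_big; apply: eq_bigr => s _.
under eq_bigr do rewrite -mulrA.
rewrite -mulr_sumr.
have -> : laurent_coef u ((-1) ^+ s * \prod_i (\matrix_(j, r) hsub K x (m j) (rev_ord r)) i (s i))
  = (-1) ^+ s * laurent_coef u (\prod_i hsub K x (m i) (rev_ord (s i))).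
  under eq_bigr do rewrite mxE.
  by case: (s : bool); rewrite ?mul1r // !mulN1r raddfN.
rewrite rmorphM rmorph_sign mulrCA; congr (_ * _).
(* A negative index makes the term zero on both sides, by [psi_neg] and by the convention in
   [hsub]. *)
have [/forallP H|] := boolP [forall i, (rev_ord (s i) <= m i)%N].
  have E i : (m i)%:Z - (rev_ord (s i))%:Z = (m i - rev_ord (s i))%N by rewrite -subzn.
  transitivity (\sum_(g : 'S_n) psi (fun i => (m i - rev_ord (s i))%N%:Z) g * wpsi (fun i => mvec (e i)) u g).
    apply: eq_bigr => g _; congr (_ * _); rewrite /psi; congr _%:R; apply: eq_card => f.
    by rewrite !inE; congr (_ && _); apply: eq_forallb => i; rewrite E.
  rewrite (@frobenius_coef _ _ _ _ K) //.
    by congr (_ * (laurent_coef _ _)%:~R); apply: eq_bigr => i _; rewrite /hsub H.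
  apply/eqP; rewrite -(eqn_add2r (\sum_(i < N) rev_ord (s i))); apply/eqP.
  rewrite -big_split /=; under eq_bigr => i _ do rewrite subnK ?H //.
  rewrite mn; congr addn; rewrite [LHS](reindex_inj (@perm_inj _ s)).
  by [].
case/forallPn => i; rewrite -ltnNge => H.
rewrite big1 => [|g _]; last by rewrite (@psi_neg _ _ _ i) ?mul0r //; lia.
by rewrite (bigD1 i) //= {1}/hsub leqNgt H mul0r raddf0 mulr0.
Qed.
End Polynomials.

(** * Young diagrams *)

Section YoungDiagram.
Variables (n : nat) (la : seq nat).
Hypotheses (la_n : sumn la = n) (la_sorted : sorted geq la).

Let row (x : 'I_n) := reshape_index la x.
Let col (x : 'I_n) := reshape_offset la x.

Lemma nth_part i j : (i <= j)%N -> (nth 0 la j <= nth 0 la i)%N.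
Proof.
move=> ij; have [jl|lj] := ltnP j (size la); last by rewrite nth_default.
have T : transitive geq by move=> a b c; rewrite /geq /= => ba ac; exact: leq_trans ac ba.
have Rf : reflexive geq by move=> a; rewrite /geq /=.
by have := sorted_leq_nth T Rf 0%N la_sorted; apply => //; rewrite inE // (leq_ltn_trans ij).
Qed.

Lemma col_lt x : (col x < nth 0 la (row x))%N.
Proof. by apply: reshape_offsetP; rewrite la_n. Qed.

Lemma row_col_inj x y : row x = row y -> col x = col y -> x = y.
Proof.
move=> r c; apply: val_inj.
by rewrite /= -(reshape_indexK la x) -(reshape_indexK la y); congr flatten_index.
Qed.

Lemma boxP r c : (c < nth 0 la r)%N -> {x | row x = r & col x = c}.
Proof.
move=> cr; have H := flatten_indexP cr; rewrite la_n in H.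
exists (Ordinal H); first exact: flatten_indexKl.
exact: flatten_indexKr.
Qed.

Lemma col_ltn x : (col x < n)%N.
Proof. by apply: leq_ltn_trans (ltn_ord x); rewrite /col /reshape_offset leq_subr. Qed.

(** With [f] read as a new row for each box, boxes of one column get distinct rows. *)
Definition col_distinct (f : 'I_n -> nat) : Prop :=
  forall x y, x != y -> col x = col y -> f x <> f y.

(** If the box of row [i] and column [c] is in the diagram, the right side is at least [i + 1], the
    number of values available to [f]. Otherwise the whole column lies in rows up to [i] and the
    right side counts all of it. *)
Lemma col_distinct_le1 f c i : col_distinct f ->
  (#|[set x | (col x == c) && (f x <= i)%N]| <=
   #|[set x | (col x == c) && (row x <= i)%N]|)%N.
Proof.
move=> fd; have [ci|ic] := ltnP c (nth 0 la i); last first.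
  apply/subset_leq_card/subsetP => x; rewrite !inE => /andP[/eqP xc _].
  rewrite xc eqxx /= leqNgt; apply/negP => ix.
  by have := col_lt x; rewrite xc ltnNge (leq_trans (nth_part (ltnW ix)) ic).
apply: (@leq_trans i.+1).
  pose g (x : 'I_n) : 'I_i.+1 := inord (f x).
  rewrite -[leqRHS]card_ord -(@card_in_imset _ _ g) ?max_card // => x y.
  rewrite !inE => /andP[/eqP xc fx] /andP[/eqP yc fy] /(congr1 val) /=.
  rewrite !inordK // => fxy; apply/eqP/negP => /negP xy.
  by apply: (fd x y) => //; rewrite xc yc.
pose g (r : 'I_i.+1) : 'I_n :=
  s2val (boxP (leq_trans ci (nth_part (leq_ord r)))).
have gr r : row (g r) = r by rewrite /g; case: boxP.
have gc r : col (g r) = c by rewrite /g; case: boxP.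
rewrite -[leqLHS]card_ord -(card_imset _ (_ : injective g)); last first.
  by move=> r s /(congr1 row); rewrite !gr => /val_inj.
apply/subset_leq_card/subsetP => _ /imsetP[r _ ->].
by rewrite inE gc gr eqxx leq_ord.
Qed.

Lemma card_col_split (S : pred nat) (A : pred 'I_n) :
  #|[set x | S (col x) && A x]| =
  (\sum_(c < n | S c) #|[set x | (col x == c) && A x]|)%N.
Proof.
rewrite -sum1dep_card (partition_big (fun x => Ordinal (col_ltn x)) (fun c => S c)) /=; last first.
  by move=> x /andP[].
apply: eq_bigr => c Sc; rewrite sum1dep_card; apply: eq_card => x; rewrite !inE.
rewrite -val_eqE /= andbC; case: eqP => //= ->; by rewrite Sc.
Qed.

Lemma col_distinct_le f (S : pred nat) i : col_distinct f ->
  (#|[set x | S (col x) && (f x <= i)%N]| <=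
   #|[set x | S (col x) && (row x <= i)%N]|)%N.
Proof.
by move=> fd; rewrite !card_col_split; apply: leq_sum => c _; apply: col_distinct_le1.
Qed.

(** The permutation [q] moves [x] within its column to row [f x]; the point is that this box
    exists. *)
Lemma col_distinct_straighten f : col_distinct f ->
  (forall r, #|[set x | f x == r]| = #|[set x | row x == r]|) ->
  exists2 q, q \in col_stab n la & forall x, f x = row (q x).
Proof.
move=> fd fr.
have cum i : #|[set x | (f x <= i)%N]| = #|[set x | (row x <= i)%N]|.
  have E (g : 'I_n -> nat) : #|[set x | (g x <= i)%N]| = (\sum_(r < i.+1) #|[set x | g x == r]|)%N.
    rewrite -sum1dep_card (partition_big (fun x => inord (g x) : 'I_i.+1) xpredT) //=.
    apply: eq_bigr => r _; rewrite sum1dep_card; apply: eq_card => x; rewrite !inE.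
    apply/andP/eqP => [[gi /eqP<-]|gr]; first by rewrite inordK.
    by rewrite gr -ltnS ltn_ord inord_val.
  by rewrite !E; apply: eq_bigr.
(* If not, column [c] lies entirely in rows before [f x], and [x] is missing among its points with
   value at most [f x - 1]. The other columns cannot compensate for this by [col_distinct_le], which
   contradicts [cum]. *)
have box x : (col x < nth 0 la (f x))%N.
  rewrite ltnNge; apply/negP => le; set c := col x in le.
  have fx0 : (0 < f x)%N.
    rewrite lt0n; apply/eqP => fx; rewrite fx in le.
    by have := leq_trans (col_lt x) (nth_part (leq0n _)); rewrite ltnNge le.
  have := cum (f x).-1.
  have split (A : pred 'I_n) : #|[set y | A y]| =
     (#|[set y | (col y == c) && A y]| + #|[set y | (col y != c) && A y]|)%N.
    rewrite -(cardsID [set y | col y == c]); congr addn; apply: eq_card => y; rewrite !inE //.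
    by rewrite andbC.
  rewrite (split (fun y => f y <= (f x).-1)%N) (split (fun y => row y <= (f x).-1)%N).
  have := col_distinct_le (fun d => d != c) (f x).-1 fd.
  suff : (#|[set y | (col y == c) && (f y <= (f x).-1)%N]| <
          #|[set y | (col y == c) && (row y <= (f x).-1)%N]|)%N by lia.
  apply: (@leq_trans #|[set y | col y == c]|).
    apply/proper_card/properP; split; first by apply/subsetP => y; rewrite !inE => /andP[].
    by exists x; rewrite !inE eqxx //= -ltnNge prednK.
  apply/subset_leq_card/subsetP => y; rewrite !inE => /eqP yc; rewrite yc eqxx /=.
  rewrite -ltnS prednK // ltnNge; apply/negP => xy.
  by have := col_lt y; rewrite yc ltnNge (leq_trans (nth_part xy) le).
pose q0 x := s2val (boxP (box x)).
have qr x : row (q0 x) = f x by rewrite /q0; case: boxP.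
have qc x : col (q0 x) = col x by rewrite /q0; case: boxP.
have qI : injective q0.
  move=> x y xy; apply/eqP/negP => /negP nxy.
  by apply: (fd x y nxy); [rewrite -qc xy qc | rewrite -qr xy qr].
exists (perm qI) => [|x]; last by rewrite permE qr.
by rewrite inE; apply/forallP => x; rewrite permE; apply/eqP/qc.
Qed.
End YoungDiagram.

(** * Young symmetrizers *)

Section YoungSymmetrizer.
Variables (n : nat) (la : seq nat).
Hypotheses (la_n : sumn la = n) (la_sorted : sorted geq la).

Let row (x : 'I_n) := reshape_index la x.
Let col (x : 'I_n) := reshape_offset la x.
Let P := row_stab n la.
Let Q := col_stab n la.

Lemma row_stabP (p : 'S_n) : reflect (forall x, row (p x) = row x) (p \in P).
Proof. by rewrite /P /Q inE; apply: (iffP forallP) => H x; apply/eqP; apply: H. Qed.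

Lemma col_stabP (q : 'S_n) : reflect (forall x, col (q x) = col x) (q \in Q).
Proof. by rewrite /P /Q inE; apply: (iffP forallP) => H x; apply/eqP; apply: H. Qed.

Lemma row_stab_group : group_set P.
Proof.
apply/group_setP; split=> [|p q]; first by apply/row_stabP => x; rewrite perm1.
by move=> /row_stabP p1 /row_stabP q1; apply/row_stabP => x; rewrite permM q1 p1.
Qed.
Canonical row_stab_groupType := Group row_stab_group.

Lemma col_stab_group : group_set Q.
Proof.
apply/group_setP; split=> [|p q]; first by apply/col_stabP => x; rewrite perm1.
by move=> /col_stabP p1 /col_stabP q1; apply/col_stabP => x; rewrite permM q1 p1.
Qed.
Canonical col_stab_groupType := Group col_stab_group.

(** The Young symmetrizer as a coefficient function on the group, which makes convolutions explicit
    sums. *)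
Definition ysym (g : 'S_n) : algC :=
  \sum_(p in P) \sum_(q in Q) (-1) ^+ (q : bool) * (p * q == g)%g%:R.

Lemma row_col_stab1 (p q : 'S_n) : p \in P -> q \in Q -> (p * q)%g = 1%g -> p = 1%g /\ q = 1%g.
Proof.
move=> /row_stabP pP qQ pq1; have pE : p = (q^-1)%g by apply/eqP; rewrite eq_mulgV1 invgK pq1.
have /col_stabP qV : (q^-1)%g \in [group of Q] by rewrite groupV.
have p1 : p = 1%g.
  apply/permP => x; rewrite perm1; apply: (row_col_inj (la := la)) => //.
    exact: pP.
  by rewrite pE; exact: qV.
by split=> //; rewrite p1 mul1g in pq1.
Qed.

Lemma ysym1 : ysym 1%g = 1.
Proof.
have P1 : 1%g \in P := group1 [group of P].
have Q1 : 1%g \in Q := group1 [group of Q].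
rewrite /ysym (bigD1 1%g) //= (bigD1 (1%g : 'S_n)) //= odd_perm1 mul1g eqxx mulr1.
rewrite big1 => [|q /andP[qQ q1]]; last by rewrite mul1g (negPf q1) mulr0.
rewrite addr0 big1 ?addr0 // => p /andP[pP p1]; rewrite big1 // => q qQ.
by case: eqP => [/(row_col_stab1 pP qQ)[E _]|_]; last rewrite mulr0 //; rewrite E eqxx in p1.
Qed.

Lemma ysymMl p g : p \in P -> ysym (p * g)%g = ysym g.
Proof.
move=> pP; rewrite /ysym (reindex_inj (mulgI p)) /=.
apply: eq_big => [k|k _]; first by rewrite (@groupMl _ [group of P]).
by apply: eq_bigr => q _; rewrite -mulgA (inj_eq (mulgI p)).
Qed.

Lemma ysymMr q g : q \in Q -> ysym (g * q)%g = (-1) ^+ (q : bool) * ysym g.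
Proof.
move=> qQ; rewrite /ysym mulr_sumr; apply: eq_bigr => p _.
rewrite (reindex_inj (mulIg q)) /= mulr_sumr.
apply: eq_big => [k|k _]; first by rewrite (@groupMr _ [group of Q]).
by rewrite mulgA (inj_eq (mulIg q)) odd_permM signr_addb mulrA [(-1) ^+ q * _]mulrC.
Qed.

(* Von Neumann's lemma. If [z g] or [ysym g] is nonzero, then no two points of a
   column of [la] are sent to a common row by [g^-1]; this forces [g \in P Q]. *)
Lemma ysym_span (z : 'S_n -> algC) :
  (forall p g, p \in P -> z (p * g)%g = z g) ->
  (forall q g, q \in Q -> z (g * q)%g = (-1) ^+ (q : bool) * z g) ->
  forall g, z g = z 1%g * ysym g.
Proof.
move=> zP zQ g.
have zpq p q : p \in P -> q \in Q -> z (p * q)%g = (-1) ^+ (q : bool) * z 1%g.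
  by move=> pP qQ; rewrite zP // -[q]mul1g zQ // mul1g.
have ypq p q : p \in P -> q \in Q -> ysym (p * q)%g = (-1) ^+ (q : bool).
  by move=> pP qQ; rewrite ysymMl // -[q]mul1g ysymMr // mul1g ysym1 mulr1.
pose f x := row (g^-1 x)%g.
have [/existsP[[x y] /= /and3P[xy /eqP cxy /eqP fxy]]|nc] :=
  boolP [exists p : 'I_n * 'I_n, [&& p.1 != p.2, col p.1 == col p.2 & f p.1 == f p.2]].
  have tQ : tperm x y \in Q.
    by apply/col_stabP => w; case: tpermP => // ->.
  have tP : (g * tperm x y * g^-1)%g \in P.
    apply/row_stabP => w; rewrite !permM; case: tpermP => [E|E|_ _]; last by rewrite permK.
      by rewrite -[LHS]/(f y) -fxy /f -E permK.
    by rewrite -[LHS]/(f x) fxy /f -E permK.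
  (* Acting on the right, the transposition changes the sign; moved across [g] it becomes an element
     of [P], which changes nothing. Hence the value at [g] is its own opposite. *)
  have gt : (g * tperm x y = (g * tperm x y * g^-1) * g)%g by rewrite mulgKV.
  have neg (w : 'S_n -> algC) : (forall p g, p \in P -> w (p * g)%g = w g) ->
      (forall q g, q \in Q -> w (g * q)%g = (-1) ^+ (q : bool) * w g) -> w g = 0.
    move=> wP wQ; have := wQ _ g tQ; rewrite gt wP // odd_tperm xy expr1 mulN1r.
    by move/eqP; rewrite -addr_eq0 -mulr2n mulrn_eq0 /= => /eqP.
  by rewrite (neg z) // (neg ysym) ?mulr0 //; [exact: ysymMl | exact: ysymMr].
have fd : col_distinct la f.
  move=> x y xy cxy fxy; case/negP: nc; apply/existsP; exists (x, y) => /=.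
  by rewrite xy (_ : col x == col y) ?fxy /=; apply/eqP.
have fr r : #|[set x | f x == r]| = #|[set x | row x == r]|.
  rewrite -[LHS](card_imset _ (@perm_inj _ (g^-1)%g)); apply: eq_card => x.
  apply/imsetP/idP => [[y]|]; first by rewrite !inE => fy ->.
  by rewrite inE => rx; exists (g x); rewrite ?permK // inE /f permK.
have [q qQ fq] := col_distinct_straighten la_n la_sorted fd fr.
have gqP : (g * q)%g \in P.
  by apply/row_stabP => x; rewrite permM -[LHS]fq /f permK.
have -> : g = ((g * q) * q^-1)%g by rewrite mulgK.
have qV : (q^-1)%g \in Q by rewrite (@groupV _ [group of Q]).
by rewrite zpq // ypq // mulrC.
Qed.

(** The coefficient of [c * c] at the identity, hence the scalar [h] with [c * c = h c], because [c]
    has coefficient 1 there. *)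
Definition ynorm : algC := \sum_k ysym k * ysym (k^-1)%g.

Lemma ysym_idem g : \sum_k ysym k * ysym (k^-1 * g)%g = ynorm * ysym g.
Proof.
rewrite (ysym_span (z := fun g => \sum_k ysym k * ysym (k^-1 * g)%g)); last first.
- move=> q w qQ; rewrite mulr_sumr; apply: eq_bigr => k _.
  by rewrite mulgA ysymMr // mulrCA.
- move=> p w pP; rewrite (reindex_inj (mulgI p)) /=; apply: eq_bigr => k _.
  by rewrite ysymMl // invMg -mulgA mulKg.
by congr (_ * _); apply: eq_bigr => k _; rewrite mulg1.
Qed.

(** For fixed [x], the inner sum is the value at [x] of a function [z] with the symmetries required
    by [ysym_span], so it equals [z 1 * ysym x]. *)
Lemma ysym_trace (y : 'S_n -> algC) : (forall p g, p \in P -> y (p * g)%g = y g) ->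
  \sum_x \sum_g ysym g * y (x * g^-1 * x^-1)%g =
  \sum_x (\sum_k y k * ysym (x^-1 * k^-1)%g) * ysym x.
Proof.
move=> yP; apply: eq_bigr => x _.
pose z w := \sum_k y k * ysym (x^-1 * k^-1 * w)%g.
transitivity (z x).
  pose h (g : 'S_n) := (x * g^-1 * x^-1)%g.
  have hK : cancel h (fun g => x^-1 * g^-1 * x)%g.
    by move=> g; rewrite /h !invMg !invgK !mulgA mulVg mul1g mulgKV.
  rewrite /z [RHS](reindex_inj (can_inj hK)); apply: eq_bigr => g _.
  by rewrite mulrC /h !invMg !invgK !mulgA mulVg mul1g mulgKV.
rewrite (ysym_span (z := z)); last first.
- by move=> q w qQ; rewrite mulr_sumr; apply: eq_bigr => k _; rewrite mulgA ysymMr // mulrCA.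
- move=> p w pP; rewrite /z (reindex_inj (mulgI p)) /=; apply: eq_bigr => k _.
  by rewrite yP // invMg !mulgA mulgKV.
by congr (_ * _); apply: eq_bigr => k _; rewrite mulg1.
Qed.

Lemma ysym_trace_self :
  \sum_x \sum_g ysym g * ysym (x * g^-1 * x^-1)%g = ynorm ^+ 2.
Proof.
rewrite ysym_trace; last by move=> p g; apply: ysymMl.
rewrite expr2 {2}/ynorm mulr_sumr; apply: eq_bigr => x _.
have -> : \sum_k ysym k * ysym (x^-1 * k^-1)%g = ynorm * ysym (x^-1)%g.
  rewrite -ysym_idem.
  pose h (g : 'S_n) := (g^-1 * x^-1)%g.
  have hK : cancel h (fun g => x^-1 * g^-1)%g by move=> g; rewrite /h !invMg !invgK mulKg.
  rewrite (reindex_inj (can_inj hK)); apply: eq_bigr => g _.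
  by rewrite /h mulrC !invMg !invgK mulKg.
by rewrite -mulrA [ysym (x^-1)%g * _]mulrC.
Qed.

Lemma ysym_trace_row :
  \sum_x \sum_g ysym g * (x * g^-1 * x^-1 \in P)%g%:R = #|P|%:R * ynorm.
Proof.
rewrite (ysym_trace (y := fun w => (w \in P)%:R)); last first.
  by move=> p g pP; rewrite (@groupMl _ [group of P]).
under eq_bigr => x _ do rewrite mulr_suml.
rewrite exchange_big /= -sum1_card natr_sum mulr_suml [RHS]big_mkcond /=.
apply: eq_bigr => k _; case: ifP => kP; last first.
  by rewrite big1 // => x _; rewrite ?kP !mul0r.
rewrite mul1r /ynorm (reindex_inj (mulgI (k^-1)%g)) /=; apply: eq_bigr => x _.
by rewrite mul1r invMg invgK -mulgA mulgV mulg1 mulrC ysymMl // (@groupV _ [group of P]).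
Qed.

Lemma card_row r : #|[set x | row x == r]| = nth 0 la r.
Proof.
pose g (c : 'I_(nth 0 la r)) : 'I_n := s2val (boxP la_n (ltn_ord c)).
have gr c : row (g c) = r by rewrite /g; case: boxP.
have gc c : col (g c) = c by rewrite /g; case: boxP.
rewrite -[RHS]card_ord -(card_imset _ (_ : injective g)); last first.
  by move=> c d /(congr1 col); rewrite !gc => /val_inj.
apply: eq_card => x; rewrite inE; apply/eqP/imsetP => [rx|[c _ ->]]; last exact: gr.
have cr : (col x < nth 0 la r)%N by rewrite -rx; apply: col_lt.
by exists (Ordinal cr) => //; apply: (row_col_inj (la := la)); [rewrite -/(row x) rx -[LHS](gr (Ordinal cr))|rewrite -/(col x) -[LHS](gc (Ordinal cr))].
Qed.

Lemma card_row_le i : #|[set x | (row x <= i)%N]| = (\sum_(r < i.+1) nth 0 la r)%N.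
Proof.
rewrite -sum1dep_card (partition_big (fun x => inord (row x) : 'I_i.+1) xpredT) //=.
apply: eq_bigr => r _; rewrite sum1dep_card -card_row; apply: eq_card => x; rewrite !inE.
apply/andP/eqP => [[gi /eqP<-]|gr]; first by rewrite inordK.
by rewrite gr -ltnS ltn_ord inord_val.
Qed.

Section Rows.
Variable N : nat.
Hypothesis laN : (size la <= N)%N.

(** For the content [la], [psi] is the permutation character on the cosets of [P]: each such word is
    [pull f0 k] for exactly [#|P|] elements [k]. This reduces the claim to [ysym_trace_row]. *)
Lemma ysym_psi_row : \sum_g ysym g * psi (fun i : 'I_N => (nth 0%N la i)%:Z) g = ynorm.
Proof.
have rN x : (row x < N)%N by apply: leq_trans laN; apply: reshape_indexP; rewrite la_n.
pose f0 : {ffun 'I_n -> 'I_N} := [ffun x => Ordinal (rN x)].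
have f0c i : content f0 i = nth 0%N la i.
  by rewrite -card_row; apply: eq_card => x; rewrite !inE ffunE -val_eqE.
have P0 : #|P|%:R != 0 :> algC.
  by rewrite pnatr_eq0 -lt0n; exact: (cardG_gt0 [group of P]).
apply: (mulfI P0); rewrite -ysym_trace_row mulr_sumr exchange_big /=.
apply: eq_bigr => g _; rewrite mulrCA -mulr_sumr; congr (_ * _).
rewrite /psi -natrM -natr_sum; congr _%:R.
have fP (k : 'S_n) : (pull (pull f0 k) g == pull f0 k) = (k^-1 * g^-1 * k^-1^-1 \in P)%g.
  have -> : (k^-1 * g^-1 * k^-1^-1 = (k^-1 * g * k)^-1)%g by rewrite !invMg !invgK !mulgA.
  rewrite (@groupV _ [group of P]).
  apply/eqP/row_stabP => [/ffunP H x|H]; last apply/ffunP => x.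
    by have := H (k^-1 x)%g; rewrite !ffunE !permM permKV => /(congr1 val).
  by have := H (k x); rewrite !ffunE !permM permK => Hx; apply: val_inj.
have fib (f : {ffun 'I_n -> 'I_N}) : [forall i : 'I_N, (content f i)%:Z == nth 0%N la i] ->
    #|[set k : 'S_n | pull f0 k == f]| = #|P|.
  move=> /forallP fc; have [k fk] : exists k, f = pull f0 k.
    by apply: content_pullP => i; rewrite f0c; have := fc i; rewrite eqz_nat eq_sym => /eqP.
  rewrite -(card_imset _ (@mulgI _ (k^-1)%g)); apply: eq_card => p.
  apply/imsetP/idP => [[h]|pP].
    rewrite inE => /eqP hf ->; apply/row_stabP => x; rewrite permM.
    by move: fk; rewrite -hf => /ffunP/(_ (k^-1 x)%g); rewrite !ffunE permKV => /(congr1 val).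
  exists (k * p)%g; last by rewrite mulKg.
  rewrite inE fk; apply/eqP/ffunP => x; rewrite !ffunE; apply: val_inj.
  by rewrite /= permM; move/row_stabP: pP; apply.
rewrite (reindex_inj invg_inj) /=; under [RHS]eq_bigr do rewrite -fP.
rewrite mulnC -sum1dep_card big_distrl /= -big_mkcond /=.
rewrite (partition_big (pull f0) (fun f : {ffun 'I_n -> 'I_N} =>
   [forall i, (content f i)%:Z == nth 0%N la i] && (pull f g == f))) /=; last first.
  by move=> k ->; rewrite andbT; apply/forallP => i; rewrite content_pull f0c.
apply: eq_bigr => f /andP[fc fg]; rewrite mul1n -(fib f) // -sum1dep_card.
by apply: eq_bigl => k; case: (pull f0 k =P f) => [->|]; rewrite ?fg ?andbF.
Qed.

(** A word either repeats a letter in some column, and is then killed by the signed sum over [Q], or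
    is distinct on columns, and then its content cannot exceed [la] in partial sums. *)
Lemma ysym_psi_eq0 (M : 'I_N -> int) (i : 'I_N) :
  \sum_(r < N | (r <= i)%N) (nth 0%N la r)%:Z < \sum_(r < N | (r <= i)%N) M r ->
  \sum_g ysym g * psi M g = 0.
Proof.
move=> lt.
transitivity (\sum_(f : {ffun 'I_n -> 'I_N} | [forall i, (content f i)%:Z == M i])
  \sum_(p in P) \sum_(q in Q) (-1) ^+ (q : bool) * (pull f (p * q)%g == f)%:R : algC).
  have E (X : 'S_n -> algC) : \sum_g ysym g * X g =
      \sum_(p in P) \sum_(q in Q) (-1) ^+ (q : bool) * X (p * q)%g.
    under eq_bigr do rewrite /ysym mulr_suml.
    rewrite exchange_big; apply: eq_bigr => p _.
    under eq_bigr do rewrite mulr_suml.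
    rewrite exchange_big; apply: eq_bigr => q _.
    rewrite (bigD1 (p * q)%g) //= eqxx mulr1 big1 ?addr0 // => g.
    by rewrite eq_sym => /negPf->; rewrite mulr0 mul0r.
  rewrite [RHS](eq_bigr (fun f : {ffun 'I_n -> 'I_N} =>
    \sum_g ysym g * (pull f g == f)%:R)) => [|f _]; last by rewrite E.
  rewrite exchange_big /=; apply: eq_bigr => g _; rewrite -mulr_sumr; congr (_ * _).
  rewrite /psi -sum1dep_card natr_sum [LHS]big_mkcondr /=; apply: eq_bigr => f _.
  by case: eqP.
rewrite big1 // => f /forallP fM; rewrite big1 // => p pP.
have [/existsP[[x y] /= /and3P[xy /eqP cxy /eqP fxy]]|nc] :=
  boolP [exists p : 'I_n * 'I_n, [&& p.1 != p.2, col p.1 == col p.2 & f p.1 == f p.2]].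
  have tQ : tperm x y \in Q.
    by apply/col_stabP => w; case: tpermP => // ->.
  set S := \sum_(q in Q) _.
  (* Multiplying [q] by the transposition of two equal letters fixes the condition and reverses the
     sign. *)
  suff : S = - S by move/eqP; rewrite -addr_eq0 -mulr2n mulrn_eq0 /= => /eqP.
  rewrite {1}/S (reindex_inj (mulIg (tperm x y))) /= -sumrN.
  apply: eq_big => [q|q _]; first by rewrite (@groupMr _ [group of Q]).
  rewrite odd_permM odd_tperm xy signr_addb expr1 mulrN1 mulNr; congr (- (_ * _)).
  congr (nat_of_bool (_ == _))%:R; rewrite mulgA pullM; congr pull.
  by apply/ffunP => w; rewrite !ffunE; case: tpermP => [->|->|//]; rewrite ?fxy.
have fd : col_distinct la (fun x => f x).
  move=> x y xy cxy /val_inj fxy; case/negP: nc; apply/existsP; exists (x, y) => /=.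
  by rewrite xy (_ : col x == col y) ?fxy /=; [rewrite eqxx|apply/eqP].
have := @col_distinct_le _ _ la_n la_sorted _ predT i fd; rewrite /=.
rewrite card_row_le.
have -> : #|[set x | (f x <= i)%N]| = (\sum_(r < N | (r <= i)%N) content f r)%N.
  rewrite -sum1dep_card (partition_big f (fun r : 'I_N => (r <= i)%N)) //=.
  apply: eq_bigr => r ri; rewrite sum1dep_card; apply: eq_card => x; rewrite !inE.
  by rewrite andbC; case: eqP => //= ->; rewrite ri.
rewrite (big_ord_widen_cond _ xpredT _ (ltn_ord i)) /= => le.
have : \sum_(r < N | (r <= i)%N) M r <= \sum_(r < N | (r <= i)%N) (nth 0%N la r)%:Z.
  rewrite (eq_bigr (fun r => (content f r)%:Z)) => [|r _]; last by apply/esym/eqP.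
  by rewrite -!(big_morph Posz PoszD (erefl _)) lez_nat.
by rewrite leNgt lt.
Qed.
End Rows.
End YoungSymmetrizer.

(** * Characters of Specht modules *)

(** In a full rank factorization [X = C B], the hypothesis forces [B C = h]; the two products have
    the same trace. *)
Lemma mxtrace_quasi_idem (F : fieldType) n (X : 'M[F]_n) (h : F) :
  X *m X = h *: X -> \tr X = h * (\rank X)%:R.
Proof.
move=> XX.
have BC : row_base X *m col_base X = h%:M.
  apply: (row_free_inj (row_base_free X)); apply: (row_full_inj (col_base_full X)).
  rewrite -mulmxA mulmx_base mulmxA mulmx_base XX.
  by rewrite mul_scalar_mx -scalemxAr mulmx_base.
by rewrite -{1}[X]mulmx_base mxtrace_mulC BC mxtrace_scalar mulr_natr.
Qed.

(** The average over the group is a projector onto the fixed vectors, so its trace is its rank. *)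
Lemma rank_rfix (gT : finGroupType) (G : {group gT}) n (rG : mx_representation algC G n) :
  (\rank (rfix_mx rG G))%:R = #|G|%:R^-1 * \sum_(g in G) \tr (rG g).
Proof.
pose E := #|G|%:R^-1 *: \sum_(g in G) rG g.
have G0 : #|G|%:R != 0 :> algC by rewrite neq0CG.
have fixE m (W : 'M_(m, n)) : {in G, forall g, W *m rG g = W} -> W *m E = W.
  move=> HW; rewrite -scalemxAr mulmx_sumr (eq_bigr (fun=> W)) //.
  by rewrite sumr_const -scaler_nat scalerA mulVf ?scale1r.
have Efix : {in G, forall g, E *m rG g = E}.
  move=> g Gg; rewrite /E -scalemxAl mulmx_suml; congr (_ *: _).
  rewrite [RHS](reindex_inj (mulIg g)) /=; apply: eq_big => [k|k Gk]; first by rewrite groupMr.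
  by rewrite repr_mxM.
have -> : \rank (rfix_mx rG G) = \rank E.
  apply/eqP; rewrite eqn_leq !mxrankS //; first exact/rfix_mxP.
  by apply/submxP; exists (rfix_mx rG G); rewrite fixE // => g; apply: rfix_mx_id.
rewrite -[LHS]mul1r -mxtrace_quasi_idem; last by rewrite scale1r fixE.
by rewrite mxtraceZ raddf_sum.
Qed.

Section SpechtTrace.
Variables (n : nat) (la : seq nat).
Hypotheses (la_n : sumn la = n) (la_sorted : sorted geq la).
Let G := [set: 'S_n]%G.
Let c := ysym (n := n) la.
Let h := ynorm n la.
(** Row [i] holds the coefficients of [c] times the [i]-th group element: this is left
    multiplication by [c], whose row space is the right ideal [c A]. *)
Let ymx : 'M[algC]_#|G| := \matrix_(i, j) c (enum_val j * (enum_val i)^-1)%g.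

Lemma sum_over_enum_val (F : 'S_n -> algC) : \sum_(i < #|G|) F (enum_val i) = \sum_g F g.
Proof.
transitivity (\sum_(g in G) F g); first by rewrite [RHS]big_enum_val.
by apply: eq_bigl => g; rewrite inE.
Qed.

Lemma ysym_mx_idem : ymx *m ymx = h *: ymx.
Proof.
apply/matrixP => i j; rewrite !mxE.
under eq_bigr do rewrite !mxE.
rewrite (sum_over_enum_val (fun k => c (k * (enum_val i)^-1)%g * c (enum_val j * k^-1)%g)).
rewrite -ysym_idem //.
have hI : injective (fun k : 'S_n => k^-1 * enum_val j)%g by move=> x y /mulIg/invg_inj.
rewrite (reindex_inj hI); apply: eq_bigr => k _.
by rewrite mulrC invMg invgK mulgA mulgV mul1g mulgA.
Qed.

Lemma mxtrace_ysym_mx : \tr ymx = n`!%:R.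
Proof.
rewrite /mxtrace; under eq_bigr do rewrite mxE mulgV /c ysym1 //.
by rewrite sumr_const card_ord cardsT card_Sn.
Qed.

(** Otherwise the trace of [ymx], which is [n!], would vanish by [mxtrace_quasi_idem]. *)
Lemma ynorm_neq0 : h != 0.
Proof.
apply/eqP => h0; have := mxtrace_quasi_idem ysym_mx_idem; rewrite mxtrace_ysym_mx h0 mul0r => /eqP.
by rewrite pnatr_eq0 => /eqP fn; have := fact_gt0 n; rewrite fn.
Qed.

Lemma regular_ysym_mxE g i j :
  (regular_repr algC G g *m ymx) i j = c (enum_val j * g^-1 * (enum_val i)^-1)%g.
Proof.
rewrite mxE (bigD1 (gring_index G (enum_val i * g)%g)) //= big1 ?addr0 => [|k /negPf ki].
  by rewrite !mxE !eqxx mul1r gring_indexK ?inE // invMg mulgA.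
by rewrite !mxE ki mul0r.
Qed.

Lemma ysym_mx_regularC g : ymx *m regular_repr algC G g = regular_repr algC G g *m ymx.
Proof.
apply/matrixP => i j; rewrite regular_ysym_mxE mxE.
have E k : (j == gring_index G (enum_val k * g)%g) = (k == gring_index G (enum_val j * g^-1)%g).
  rewrite -!(inj_eq (can_inj (@gring_valK _ G))) !gring_indexK ?inE //.
  by apply/eqP/eqP => ->; rewrite ?mulgK ?mulgKV.
rewrite (bigD1 (gring_index G (enum_val j * g^-1)%g)) //= big1 ?addr0 => [|k /negPf ki].
  by rewrite !mxE E !eqxx mulr1 gring_indexK ?inE.
by rewrite !mxE E ki mulr0.
Qed.

Lemma mxtrace_regular_ysym_mx g : \tr (regular_repr algC G g *m ymx) = \sum_x c (x * g^-1 * x^-1)%g.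
Proof.
rewrite /mxtrace; under eq_bigr do rewrite regular_ysym_mxE.
exact: (sum_over_enum_val (fun x => c (x * g^-1 * x^-1)%g)).
Qed.

Lemma young_symmetrizerE : young_symmetrizer n la = row (gring_index G 1%g) ymx.
Proof.
apply/rowP => j; rewrite !mxE gring_indexK ?group1 // invg1 mulg1 summxE.
apply: eq_bigr => p _; rewrite summxE; apply: eq_bigr => q _.
rewrite !mxE eqxx /=; congr (_ * (nat_of_bool _)%:R).
by rewrite -(inj_eq (can_inj (@gring_valK _ G))) gring_indexK ?inE // eq_sym.
Qed.

Lemma cyclic_young_symmetrizer : (cyclic_mx (regular_repr algC G) (young_symmetrizer n la) :=: ymx)%MS.
Proof.
apply/eqmxP/andP; split.
  apply: cyclic_mx_sub; last by rewrite young_symmetrizerE row_sub.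
  by apply/mxmoduleP => g _; rewrite ysym_mx_regularC submxMl.
apply/row_subP => i.
have -> : row i ymx = young_symmetrizer n la *m regular_repr algC G (enum_val i).
  rewrite young_symmetrizerE -row_mul ysym_mx_regularC; apply/rowP => j; rewrite [RHS]mxE regular_ysym_mxE mxE.
  by rewrite mxE gring_indexK ?group1 // invg1 mulg1.
by rewrite mxmodule_trans ?cyclic_mx_module ?inE ?cyclic_mx_id.
Qed.

(** [h^-1 *: ymx] is a projector onto the Specht module that commutes with the group, so the trace
    of [g] on the module is that of [g] times this projector on the whole group algebra. *)
Lemma mxtrace_specht g :
  \tr (specht n la g) = h^-1 * \sum_x c (x * g^-1 * x^-1)%g.
Proof.
rewrite -mxtrace_regular_ysym_mx /specht /=; set U := cyclic_mx _ _; rewrite /submod_mx.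
pose B := row_base U.
have UL : (U :=: ymx)%MS := cyclic_young_symmetrizer.
have [C CB] : exists C, ymx = C *m B by apply/submxP; rewrite eq_row_base UL.
have BL : B *m ymx = h *: B.
  have /submxP[D ->] : (B <= ymx)%MS by rewrite eq_row_base UL.
  by rewrite -mulmxA ysym_mx_idem scalemxAr.
have -> : val_submod 1%:M = B by rewrite /val_submod /= mul1mx.
have -> : B *m regular_repr algC G g = val_submod (h^-1 *: (B *m regular_repr algC G g *m C)).
  rewrite /val_submod /= -/B -scalemxAl -mulmxA -CB -mulmxA -ysym_mx_regularC mulmxA BL.
  by rewrite -scalemxAl scalerA mulVf ?scale1r // ynorm_neq0.
by rewrite val_submodK mxtraceZ -mulmxA mxtrace_mulC -mulmxA -CB.
Qed.
End SpechtTrace.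

(** * Weyl denominators as products of shift operators *)

Section Weyl.
Import mpoly.
Local Open Scope ring_scope.
Variables (d N : nat) (e : 'I_N -> 'X_{1..d}).
Let x (i : 'I_N) : {mpoly int[d]} := 'X_[e i].
Let pairs := [seq p : 'I_N * 'I_N <- enum {: 'I_N * 'I_N} | (p.1 < p.2)%N].

Lemma sum_pairs_fst (V : zmodType) (F : 'I_N -> V) :
  \sum_(p <- pairs) F p.1 = \sum_i F i *+ rev_ord i.
Proof.
rewrite big_filter big_enum_cond /= -(pair_big_dep xpredT (fun i j : 'I_N => (i < j)%N) (fun i _ => F i)) /=.
apply: eq_bigr => i _; rewrite sumr_const; congr (_ *+ _).
rewrite -sum1_card -(big_geq_mkord i.+1 N xpredT (fun=> 1%N)).
by rewrite sum_nat_const_nat muln1.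
Qed.

(** The product of the [1 - x_j / x_i] over [i < j] is the Vandermonde determinant divided by the
    monomial with exponents [rho], whence the translation. *)
Lemma shift_prod_pairs P v :
  shift_prod [seq mvec (e p.2) - mvec (e p.1) | p <- pairs] (fun u => laurent_coef u P) v =
  laurent_coef (v + \sum_i mvec (e i) *+ rev_ord i)
    (P * \det (\matrix_(j, i) x i ^+ rev_ord j)).
Proof.
have -> : [seq mvec (e p.2) - mvec (e p.1) | p <- pairs] =
    [seq mvec q.2 - mvec q.1 | q <- [seq (e p.1, e p.2) | p <- pairs]].
  by rewrite -map_comp.
rewrite shift_prod_laurent !big_map (sum_pairs_fst (fun i => mvec (e i))).
rewrite mulrC det_rev_Vandermonde; congr (laurent_coef _ (_ * _)).
by rewrite big_filter big_enum_cond.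
Qed.

Lemma laurent_coef_monomial_det (m : 'I_N -> nat) v P :
  laurent_coef v (P * \det (\matrix_(j, i) x i ^+ m j)) =
  \sum_(s : 'S_N) (-1) ^+ s * laurent_coef (v - \sum_i mvec (e i) *+ m (s i)) P.
Proof.
rewrite -det_tr /determinant mulr_sumr raddf_sum; apply: eq_bigr => s _ /=.
under eq_bigr do rewrite !mxE /x mpolyXn.
rewrite mprodXE mulrCA.
have -> Q : laurent_coef v ((-1) ^+ s * Q) = (-1) ^+ s * laurent_coef v Q.
  by case: (s : bool); rewrite ?mul1r // !mulN1r raddfN.
rewrite [P * _]mulrC laurent_coefXM mvec_sum; congr (_ * laurent_coef (v - _) _).
by apply: eq_bigr => i _; rewrite mvecMn.
Qed.

Lemma shift_prod_pairs_sum P v :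
  shift_prod [seq mvec (e p.2) - mvec (e p.1) | p <- pairs] (fun u => laurent_coef u P) v =
  \sum_(s : 'S_N) (-1) ^+ s *
    laurent_coef (v + \sum_i mvec (e i) *+ rev_ord i - \sum_i mvec (e i) *+ rev_ord (s i)) P.
Proof.
by rewrite shift_prod_pairs (laurent_coef_monomial_det (fun j => rev_ord j)).
Qed.

(** By Jacobi-Trudi the product with the denominator is [det (x_i ^ m_j)], a signed sum of [N!]
    monomials. *)
Lemma shift_prod_pairs_jt K (m : 'I_N -> nat) v :
  (N <= K)%N -> (forall j, m j <= K)%N ->
  shift_prod [seq mvec (e p.2) - mvec (e p.1) | p <- pairs]
    (fun u => laurent_coef u (\det (\matrix_(j, r) hsub K x (m j) (rev_ord r)))) v =
  \sum_(s : 'S_N) (-1) ^+ s *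
    (v + \sum_i mvec (e i) *+ rev_ord i == \sum_i mvec (e i) *+ m (s i))%:R.
Proof.
move=> NK mK; rewrite shift_prod_pairs -jacobi_trudi // -[\det _]mul1r laurent_coef_monomial_det.
apply: eq_bigr => s _; congr (_ * _).
by rewrite -mpolyX0 laurent_coefX mvec0 eq_sym subr_eq0.
Qed.
End Weyl.

Lemma eq_psi n (I : finType) (M M' : I -> int) (g : 'S_n) :
  M =1 M' -> psi M g = psi M' g.
Proof.
move=> MM'; rewrite /psi; congr _%:R; apply: eq_card => f; rewrite !inE.
by congr (_ && _); apply: eq_forallb => i; rewrite MM'.
Qed.

(** The smallest moved point can only go up: smaller values are taken by fixed points. *)
Lemma perm_lt_moved N (s : 'S_N) : s != 1%g ->
  exists i : 'I_N, (i < s i)%N /\ forall j : 'I_N, (j < i)%N -> s j = j.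
Proof.
move=> s1; have [i0 Hi0] : exists i, s i != i.
  apply/existsP; rewrite -negb_forall; apply: contra s1 => /forallP H.
  by apply/eqP/permP => i; rewrite perm1; apply/eqP.
have [i si min] := @arg_minnP _ i0 (fun i => s i != i) (@nat_of_ord N) Hi0.
have fixlt (j : 'I_N) : (j < i)%N -> s j = j.
  by move=> ji; apply/eqP/negPn/negP => /min; rewrite leqNgt ji.
exists i; split=> //; rewrite ltn_neqAle eq_sym (inj_eq val_inj) si leqNgt.
by apply/negP => /fixlt /perm_inj E; rewrite E eqxx in si.
Qed.

Lemma psiV n (I : finType) (M : I -> int) (g : 'S_n) : psi M (g^-1)%g = psi M g.
Proof.
rewrite /psi; congr _%:R; apply: eq_card => f; rewrite !inE; congr (_ && _).
by apply/eqP/eqP => E; rewrite -{1}E -pullM ?mulgV ?mulVg; apply/ffunP => x; rewrite ffunE perm1.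
Qed.

Lemma psiJ n (I : finType) (M : I -> int) (g x : 'S_n) : psi M (x * g * x^-1)%g = psi M g.
Proof.
rewrite /psi; congr _%:R.
have pI h : injective (fun f : {ffun 'I_n -> I} => pull f h).
  move=> f f' /ffunP E; apply/ffunP => y; have := E (h^-1 y)%g.
  by rewrite !ffunE permKV.
rewrite -(card_imset _ (pI (x^-1)%g)); apply: eq_card => f; rewrite [RHS]inE.
have -> : f = pull (pull f x) (x^-1)%g.
  by rewrite -pullM mulVg; apply/ffunP => y; rewrite ffunE perm1.
move: (pull f x) => {}f; rewrite (mem_imset _ _ (pI _)) inE; congr (_ && _).
  by apply: eq_forallb => i; rewrite content_pull.
rewrite -mulgA (pullM f x) pullM -[RHS](inj_eq (pI x)) /=; congr (_ == _).
by rewrite -[RHS]pullM mulgV; apply/ffunP => y; rewrite !ffunE perm1.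
Qed.

Lemma phiV n N (m : 'I_N -> nat) (g : 'S_n) : phi m (g^-1)%g = phi m g.
Proof. by apply: eq_bigr => s _; rewrite psiV. Qed.

Lemma phiJ n N (m : 'I_N -> nat) (g x : 'S_n) : phi m (x * g * x^-1)%g = phi m g.
Proof. by apply: eq_bigr => s _; rewrite psiJ. Qed.

Section MonomialContent.
Import mpoly.
Local Open Scope ring_scope.

Lemma sum_mvecU N (a : 'I_N -> nat) : \sum_i mvec U_(i)%MM *+ a i = \row_i (a i)%:Z.
Proof.
apply/rowP => j; rewrite summxE mxE (bigD1 j) //= big1 => [|i ij].
  by rewrite addr0 mulmxnE mxE mnm1E eqxx -mulr_natr mul1r natz.
by rewrite mulmxnE mxE mnm1E (negPf ij) mul0rn.
Qed.

Lemma wpsi_psi n N (M : 'I_N -> int) (g : 'S_n) :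
  wpsi (fun i : 'I_N => mvec U_(i)%MM) (\row_i M i) g = psi M g.
Proof.
rewrite /psi /wpsi; congr _%:R; apply: eq_card => f; rewrite !inE; congr (_ && _).
rewrite (sum_content (fun i : 'I_N => mvec U_(i)%MM)) sum_mvecU; apply/eqP/forallP => [/rowP H i|H].
  by have := H i; rewrite !mxE => ->.
by apply/rowP => i; rewrite !mxE; apply/eqP.
Qed.
End MonomialContent.

(** * The character of the Specht module is [phi] *)

Section SpechtCharacter.
Variables (n N : nat) (la : seq nat).
Hypotheses (la_n : sumn la = n) (la_sorted : sorted geq la) (laN : (size la <= N)%N).
Let m (i : 'I_N) : nat := (nth 0%N la i + rev_ord i)%N.

Lemma part_sum : (\sum_(i < N) nth 0%N la i = n)%N.
Proof.
rewrite -la_n sumnE (big_nth 0%N) big_mkord (big_ord_widen N (fun i => nth 0%N la i) laN).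
rewrite [RHS]big_mkcond; apply: eq_bigr => i _; case: ltnP => // le; exact: nth_default.
Qed.

Lemma exponent_sum : (\sum_i m i = n + \sum_(i < N) rev_ord i)%N.
Proof. by rewrite big_split /= part_sum. Qed.

Lemma exponent_le i : (m i <= n + N)%N.
Proof.
rewrite leq_add ?(ltnW (ltn_ord _)) // -part_sum (bigD1 i) //=; exact: leq_addr.
Qed.

Lemma exponent_lt (i j : 'I_N) : (i < j)%N -> (m j < m i)%N.
Proof.
move=> ij; rewrite /m /= -addnS leq_add ?(nth_part la_sorted (ltnW ij)) //.
by have := ltn_ord j; lia.
Qed.

(** Only [s = 1] contributes: for other [s], [la + rho - s rho] agrees with [la] before the first
    moved point [i] and exceeds it there by [s i - i], so [ysym_psi_eq0] applies. *)
Lemma ysym_phi : \sum_g ysym la g * phi (n := n) m g = ynorm n la.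
Proof.
under eq_bigr do rewrite /phi mulr_sumr.
rewrite exchange_big (bigD1 1%g) //= odd_perm1 expr0.
rewrite [X in _ + X]big1 ?addr0 => [|s s1].
  rewrite -(ysym_psi_row la_n la_sorted laN); apply: eq_bigr => g _.
  by rewrite mul1r; congr (_ * _); apply: eq_psi => i; rewrite perm1 /m PoszD addrK.
under eq_bigr do rewrite mulrCA.
rewrite -mulr_sumr; have [i [isi fixi]] := perm_lt_moved s1.
rewrite (ysym_psi_eq0 la_n la_sorted (i := i)) ?mulr0 //.
rewrite [ltLHS](bigD1 i) //= [ltRHS](bigD1 i) //=; apply: ltr_leD.
  by rewrite /m /=; have := ltn_ord (s i); lia.
apply: ler_sum => j /andP[ji nji]; rewrite fixi /m ?PoszD ?addrK //.
by rewrite ltn_neqAle ji andbT (inj_eq val_inj).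
Qed.

Section Norm.
Import mpoly.
Local Open Scope ring_scope.

(** Pairing [phi] with each [psi] of the second factor gives coefficients of the Schur polynomial
    [S]. Their alternating sum is the coefficient at [la + rho] of [S] times the Vandermonde
    determinant, equal to 1 because [m] is strictly decreasing. *)
Lemma phi_norm : \sum_(g : 'S_n) phi m g * phi m g = n`!%:R.
Proof.
have NK : (n <= n + N)%N := leq_addr N n.
pose S := \det (\matrix_(j, r) hsub (n + N) (fun i : 'I_N => 'X_[U_(i)] : {mpoly int[N]}) (m j) (rev_ord r)).
under eq_bigr do rewrite {2}/phi mulr_sumr.
rewrite exchange_big /=.
rewrite (eq_bigr (fun s : 'S_N => n`!%:R * ((-1) ^+ s * laurent_coef
   (\row_i (nth 0%N la i)%:Z + \sum_i mvec U_(i)%MM *+ rev_ord i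
    - \sum_i mvec U_(i)%MM *+ rev_ord (s i)) S)%:~R)).
  rewrite -mulr_sumr -rmorph_sum -shift_prod_pairs_sum.
  rewrite (shift_prod_pairs_jt (fun i : 'I_N => U_(i)%MM)) ?leq_addl //; last exact: exponent_le.
  rewrite (bigD1 (1%g : 'S_N)) //= odd_perm1 mul1r [X in _ + X]big1 => [|s s1].
    rewrite !sum_mvecU addr0 (_ : (_ == _) = true) ?mulr1 //.
  by apply/eqP/rowP => i; rewrite !mxE perm1 /m PoszD.
  rewrite !sum_mvecU; case: eqP => [E|]; last by rewrite mulr0.
  have [i [isi _]] := perm_lt_moved s1.
  have {E} := congr1 (fun u : 'rV[int]_N => u 0 i) E.
  by have := exponent_lt isi; rewrite /= !mxE /m /= => lt /eqP; rewrite -PoszD eqz_nat => /eqP E; rewrite E ltnn in lt.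
move=> s _; under eq_bigr do rewrite mulrCA.
rewrite -mulr_sumr rmorphM rmorph_sign mulrCA -frobenius_phi ?exponent_sum //.
congr (_ * _); apply: eq_bigr => g _; congr (_ * _).
rewrite -wpsi_psi; congr (wpsi _ _ _).
by rewrite !sum_mvecU; apply/rowP => i; rewrite !mxE /m PoszD.
Qed.

End Norm.

Let chi g := \tr (specht n la g).

Lemma chiE g : chi g = (ynorm n la)^-1 * \sum_x ysym la (x * g^-1 * x^-1)%g.
Proof. exact: mxtrace_specht. Qed.

Lemma chiJ g x : chi (x * g * x^-1)%g = chi g.
Proof.
rewrite !chiE; congr (_ * _); rewrite [RHS](reindex_inj (mulIg x)) /=.
by apply: eq_bigr => y _; rewrite !invMg !invgK !mulgA.
Qed.

Lemma sum_chi (F : 'S_n -> algC) : (forall g x, F (x * g * x^-1)%g = F g) ->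
  \sum_g chi g * F (g^-1)%g = n`!%:R * ((ynorm n la)^-1 * \sum_g ysym la g * F g).
Proof.
move=> FJ; under eq_bigr do rewrite chiE -mulrA mulr_suml.
rewrite -mulr_sumr exchange_big mulrCA /=; congr (_ * _).
have -> : n`!%:R = #|'S_n|%:R :> algC by rewrite card_Sn.
rewrite -sum1_card natr_sum mulr_suml; apply: eq_bigr => x _; rewrite mul1r.
pose f (g : 'S_n) := (x * g^-1 * x^-1)%g.
have fI : injective f by move=> g h /mulIg/mulgI/invg_inj.
by rewrite [RHS](reindex_inj fI); apply: eq_bigr => g _; rewrite /f FJ.
Qed.

Lemma chi_conj g : chi (g^-1)%g = (chi g)^*.
Proof.
have := char_inv g (cfRepr_char (specht n la)).
by rewrite !cfunE !inE.
Qed.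

(** The products of [chi] with itself, of [phi] with itself and of [chi] with [phi] all sum to [n!],
    so the squared norm of [chi - phi] is zero. *)
Lemma specht_phi g : chi g = phi m g.
Proof.
have h0 : ynorm n la != 0 by apply: ynorm_neq0.
have cc : \sum_g chi g * chi (g^-1)%g = n`!%:R.
  rewrite sum_chi; last exact: chiJ.
  under [X in _ * (_ * X)]eq_bigr do rewrite chiE mulrCA mulr_sumr.
  by rewrite -mulr_sumr exchange_big ysym_trace_self // expr2 mulKf // mulVf // mulr1.
have cp : \sum_g chi g * phi m (g^-1)%g = n`!%:R.
  by rewrite sum_chi; [rewrite ysym_phi mulVf ?mulr1 | exact: phiJ].
have pc : \sum_(g : 'S_n) phi m g * chi (g^-1)%g = n`!%:R.
  by rewrite -[RHS]cp [RHS](reindex_inj invg_inj); apply: eq_bigr => k _; rewrite invgK mulrC.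
have phi_real k : (phi m k)^* = phi m k :> algC.
  rewrite rmorph_sum; apply: eq_bigr => s _.
  by rewrite rmorphM rmorph_sign /psi rmorph_nat.
have : \sum_(k : 'S_n) `|chi k - phi m k| ^+ 2 = 0.
  have E k : `|chi k - phi m k| ^+ 2 = chi k * chi (k^-1)%g - chi k * phi m k
      - (phi m k * chi (k^-1)%g - phi m k * phi m k).
    by rewrite normCK [_^*]rmorphB /= phi_real -/(chi k) -chi_conj mulrBl !mulrBr.
  under eq_bigr do rewrite E.
  rewrite !sumrB /= cc pc phi_norm.
  have -> : \sum_(k : 'S_n) chi k * phi m k = n`!%:R.
    by rewrite -[RHS]cp; apply: eq_bigr => k _; rewrite phiV.
  by rewrite !subrr.
move/eqP; rewrite psumr_eq0 => [/allP/(_ g)|k _]; last by rewrite exprn_ge0.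
rewrite mem_index_enum expf_eq0 normr_eq0 subr_eq0 /= => /(_ isT)/eqP //.
Qed.
End SpechtCharacter.

(** * Kronecker coefficients *)

Lemma kron_phi N1 N2 N3 n (la mu nu : seq nat) :
  sumn la = n -> sumn mu = n -> sumn nu = n ->
  sorted geq la -> sorted geq mu -> sorted geq nu ->
  (size la <= N1)%N -> (size mu <= N2)%N -> (size nu <= N3)%N ->
  n`!%:R * (kron la mu nu)%:R = \sum_(g : 'S_n)
    phi (fun i : 'I_N1 => nth 0%N la i + rev_ord i)%N g *
    phi (fun i : 'I_N2 => nth 0%N mu i + rev_ord i)%N g *
    phi (fun i : 'I_N3 => nth 0%N nu i + rev_ord i)%N g.
Proof.
move=> la_n mu_n nu_n las mus nus laN muN nuN.
rewrite /kron la_n mu_n nu_n eqxx /= rank_rfix cardsT card_Sn mulVKf; last first.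
  by rewrite pnatr_eq0 -lt0n fact_gt0.
apply: eq_big => [g|g _]; first by rewrite inE.
rewrite -(specht_phi la_n las laN) -(specht_phi mu_n mus muN) -(specht_phi nu_n nus nuN).
by rewrite [LHS]mxtrace_prod mxtrace_prod.
Qed.

Lemma shift_prod_comp (V W : zmodType) (f : V -> W) (c : W -> int) (s : seq V) v :
  {morph f : x y / x - y} ->
  shift_prod s (fun u => c (f u)) v = shift_prod [seq f w | w <- s] c (f v).
Proof. by move=> fB; elim: s v => //= w s IH v; rewrite /shift_diff !IH fB. Qed.

Lemma shift_prod_translate (V : zmodType) (c : V -> int) (t : V) (s : seq V) v :
  shift_prod s (fun u => c (u + t)) v = shift_prod s c (v + t).
Proof. by elim: s v => //= w s IH v; rewrite /shift_diff !IH addrAC. Qed.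

(** * The Schur function at the products of two alphabets *)

Section Boxes.
Import mpoly.
Local Open Scope ring_scope.
Variables (a b : nat) (T : 'I_a * 'I_b -> 'I_(a * b)) (box : 'I_(a * b) -> 'I_a * 'I_b).
Hypotheses (TK : cancel T box) (boxK : cancel box T).

Let ex (i : 'I_a) : 'X_{1..a + b} := U_(lshift b i)%MM.
Let ey (j : 'I_b) : 'X_{1..a + b} := U_(rshift a j)%MM.
(** The exponent vector of the monomial [x_i y_j], where [(i, j)] is the box with entry [p]. *)
Let e p : 'X_{1..a + b} := (ex (box p).1 + ey (box p).2)%MM.

Lemma mvecU m (i : 'I_m) : mvec U_(i)%MM = delta_mx 0 i.
Proof. by apply/rowP => j; rewrite !mxE mnm1E eqxx eq_sym /=; case: eqP. Qed.

Lemma mvec_ex i : mvec (ex i) = row_mx (delta_mx 0 i) 0.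
Proof. by rewrite mvecU -[LHS]hsubmxK; congr row_mx; apply/rowP => j; rewrite !mxE ?eq_lshift ?eq_rlshift ?andbF. Qed.

Lemma mvec_ey j : mvec (ey j) = row_mx 0 (delta_mx 0 j).
Proof. by rewrite mvecU -[LHS]hsubmxK; congr row_mx; apply/rowP => i; rewrite !mxE ?eq_rshift ?eq_lrshift ?andbF. Qed.

Lemma mvec_e p : mvec (e p) = row_mx (delta_mx 0 (box p).1) (delta_mx 0 (box p).2).
Proof. by rewrite mvecD mvec_ex mvec_ey add_row_mx addr0 add0r. Qed.

Lemma sum_row_mx (I : finType) (A : I -> 'rV[int]_a) (B : I -> 'rV[int]_b) :
  \sum_i row_mx (A i) (B i) = row_mx (\sum_i A i) (\sum_i B i).
Proof.
apply: (big_ind3 (fun x y z => x = row_mx y z)) => //; first by rewrite row_mx0.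
by move=> x1 x2 x3 y1 y2 y3 -> ->; rewrite add_row_mx.
Qed.

(** A word in boxes is a pair of words, and its total weight is the pair of their contents. *)
Lemma wpsi_box n (A : 'rV[int]_a) (B : 'rV[int]_b) (g : 'S_n) :
  wpsi (fun p => mvec (e p)) (row_mx A B) g =
  psi (fun i => A 0 i) g * psi (fun j => B 0 j) g.
Proof.
rewrite -[psi (fun j => B 0 j) g]wpsi_psi psi_wpsi; congr _%:R.
pose h (F : {ffun 'I_n -> 'I_a * 'I_b}) : {ffun 'I_n -> 'I_(a * b)} := [ffun x => T (F x)].
have hI : injective h.
  move=> F F' /ffunP E; apply/ffunP => x; have := E x; rewrite !ffunE; exact: can_inj TK _ _.
rewrite -[RHS](card_imset _ hI); apply: eq_card => f.
have -> : f = h [ffun x => box (f x)] by apply/ffunP => x; rewrite !ffunE boxK.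
move: [ffun x => box (f x)] => {f} F; rewrite (mem_imset _ _ hI) !inE; congr (_ && _).
  have -> : \sum_x mvec (e (h F x)) = row_mx (\sum_x delta_mx 0 (F x).1) (\sum_x delta_mx 0 (F x).2).
    by rewrite -sum_row_mx; apply: eq_bigr => x _; rewrite mvec_e ffunE TK.
  have -> : \row_j B 0 j = B by apply/rowP => j; rewrite mxE.
  rewrite (eq_bigr (fun x => mvec U_((F x).2)%MM)) => [|x _]; last by rewrite mvecU.
  have fstE i : (\sum_x delta_mx 0 (F x).1 : 'rV[int]_a) 0 i = content [ffun x => (F x).1] i.
    have := sum_content (fun i => mvec U_(i)%MM) [ffun x => (F x).1].
    rewrite sum_mvecU => /rowP/(_ i); rewrite mxE => <-; rewrite !summxE.
    by apply: eq_bigr => x _; rewrite mvecU ffunE.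
  apply/eqP/andP => [/eq_row_mx[<- <-]|[/forallP cA /eqP <-]].
    by split=> //; apply/forallP => i; rewrite fstE.
  by congr row_mx; apply/rowP => i; rewrite fstE; apply/eqP.
rewrite -(inj_eq hI); congr (_ == _).
by apply/ffunP => x; rewrite !ffunE.
Qed.

Let joinv (u : 'rV[int]_a * 'rV[int]_b) : 'rV[int]_(a + b) := row_mx u.1 u.2.

Lemma joinvB : {morph joinv : u v / u - v}.
Proof. by move=> u v; rewrite /joinv /= opp_row_mx add_row_mx. Qed.

Lemma joinv_inj : injective joinv.
Proof. by move=> [u1 u2] [v1 v2] /eq_row_mx[/= -> ->]. Qed.

Lemma joinv_sum (k : 'I_(a * b) -> nat) :
  joinv (\sum_p (delta_mx 0 (box p).1, delta_mx 0 (box p).2) *+ k p) =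
  \sum_p mvec (e p) *+ k p.
Proof.
have joinv0 : joinv 0 = 0 by rewrite /joinv row_mx0.
have joinvD : {morph joinv : u v / u + v}.
  by move=> u v; rewrite /joinv add_row_mx.
rewrite (big_morph _ joinvD joinv0); apply: eq_bigr => p _.
rewrite mvec_e; elim: (k p) => [|j IH]; first by rewrite !mulr0n.
by rewrite !mulrS joinvD IH.
Qed.

Lemma sum_mvec_ex (k : 'I_a -> nat) :
  \sum_i mvec (ex i) *+ k i = row_mx (\row_i (k i)%:Z) 0.
Proof.
rewrite -sum_mvecU.
rewrite (eq_bigr (fun i => row_mx (mvec U_(i)%MM *+ k i) (0 : 'rV[int]_b))) => [|i _].
  by rewrite sum_row_mx [X in row_mx _ X]big1.
by rewrite mvec_ex mvecU; elim: (k i) => [|j IH]; rewrite ?mulr0n ?row_mx0 // !mulrS IH add_row_mx addr0.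
Qed.

Lemma sum_mvec_ey (k : 'I_b -> nat) :
  \sum_j mvec (ey j) *+ k j = row_mx 0 (\row_j (k j)%:Z).
Proof.
rewrite -sum_mvecU.
rewrite (eq_bigr (fun i => row_mx (0 : 'rV[int]_a) (mvec U_(i)%MM *+ k i))) => [|i _].
  by rewrite sum_row_mx [X in row_mx X _]big1.
by rewrite mvec_ey mvecU; elim: (k i) => [|j IH]; rewrite ?mulr0n ?row_mx0 // !mulrS IH add_row_mx addr0.
Qed.

Lemma joinv_row_weights : [seq joinv w | w <- row_weights a b] =
  [seq mvec (ex p.2) - mvec (ex p.1) | p : 'I_a * 'I_a <- enum {: 'I_a * 'I_a} & (p.1 < p.2)%N].
Proof.
rewrite -map_comp; apply: eq_map => p.
by rewrite /joinv /= !mvec_ex opp_row_mx add_row_mx subrr.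
Qed.

Lemma joinv_col_weights : [seq joinv w | w <- col_weights a b] =
  [seq mvec (ey p.2) - mvec (ey p.1) | p : 'I_b * 'I_b <- enum {: 'I_b * 'I_b} & (p.1 < p.2)%N].
Proof.
rewrite -map_comp; apply: eq_map => p.
by rewrite /joinv /= !mvec_ey opp_row_mx add_row_mx subrr.
Qed.

Lemma joinv_box_weights : perm_eq [seq joinv w | w <- box_weights T]
  [seq mvec (e p.2) - mvec (e p.1) | p : 'I_(a * b) * 'I_(a * b) <-
     enum {: 'I_(a * b) * 'I_(a * b)} & (p.1 < p.2)%N].
Proof.
pose f (p : 'I_(a * b) * 'I_(a * b)) := (box p.1, box p.2).
have fI : injective f.
  by move=> [p q] [p' q'] [/(can_inj boxK) -> /(can_inj boxK) ->].
have : perm_eq [seq pq : ('I_a * 'I_b) * ('I_a * 'I_b) <- enum {: ('I_a * 'I_b) * ('I_a * 'I_b)} | (T pq.1 < T pq.2)%N]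
    [seq f p | p : 'I_(a * b) * 'I_(a * b) <- enum {: 'I_(a * b) * 'I_(a * b)} & (p.1 < p.2)%N].
  apply: uniq_perm; first by rewrite filter_uniq ?enum_uniq.
    by rewrite (map_inj_uniq fI) filter_uniq ?enum_uniq.
  move=> [p q]; rewrite mem_filter mem_enum andbT /=.
  have -> : (p, q) = f (T p, T q) by rewrite /f /= !TK.
  by rewrite mem_map // mem_filter mem_enum andbT.
rewrite /box_weights -map_comp => /(perm_map (joinv \o (fun pq : ('I_a * 'I_b) * ('I_a * 'I_b) =>
  (delta_mx 0 pq.2.1 - delta_mx 0 pq.1.1, delta_mx 0 pq.2.2 - delta_mx 0 pq.1.2)))) H.
apply: (perm_trans H); rewrite -map_comp.
rewrite (eq_map (g := fun p => mvec (e p.2) - mvec (e p.1))) ?perm_refl // => p.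
by rewrite /= !mvec_e /joinv /= opp_row_mx add_row_mx.
Qed.

Variables (n : nat) (la : seq nat).
Hypotheses (la_n : sumn la = n) (la_sorted : sorted geq la) (la_size : (size la <= a * b)%N).
Let m (p : 'I_(a * b)) : nat := (nth 0%N la p + rev_ord p)%N.
(** The Schur function of [la] at the elements [x_i y_j], in Jacobi-Trudi form. *)
Let S : {mpoly int[a + b]} :=
  \det (\matrix_(j, r) hsub (n + a * b) (fun p => 'X_[e p] : {mpoly int[a + b]}) (m j) (rev_ord r)).
Let c (u : 'rV[int]_a * 'rV[int]_b) : int := laurent_coef (joinv u) S.

Lemma shift_prod_box_weights v :
  shift_prod (box_weights T) c v = \sum_(s : 'S_(a * b)) (-1) ^+ s *
    (v + \sum_p (delta_mx 0 (box p).1, delta_mx 0 (box p).2) *+ rev_ord p ==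
     \sum_p (delta_mx 0 (box p).1, delta_mx 0 (box p).2) *+ m (s p))%:R.
Proof.
apply: (etrans (shift_prod_comp (fun u => laurent_coef u S) _ _ joinvB)).
rewrite (shift_prod_perm _ joinv_box_weights).
rewrite shift_prod_pairs_jt ?leq_addl //; last exact: exponent_le.
apply: eq_bigr => s _; congr (_ * (nat_of_bool _)%:R).
rewrite -!joinv_sum -(inj_eq joinv_inj); congr (_ == _).
by rewrite -[RHS]add_row_mx.
Qed.

Lemma shift_prod_row_col_weights A B :
  shift_prod (row_weights a b ++ col_weights a b) c (A, B) =
  \sum_(s : 'S_a) \sum_(t : 'S_b) (-1) ^+ s * ((-1) ^+ t *
    laurent_coef (row_mx (\row_i (A 0 i + (rev_ord i)%:Z - (rev_ord (s i))%:Z))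
                         (\row_j (B 0 j + (rev_ord j)%:Z - (rev_ord (t j))%:Z))) S).
Proof.
apply: (etrans (shift_prod_comp (fun u => laurent_coef u S) _ _ joinvB)).
rewrite map_cat joinv_row_weights joinv_col_weights shift_prod_cat.
(* The column operators replace [S], up to translation, by its product with the Vandermonde
   determinant in the [y_j]; the row operators then act on [D] in the same way. *)
pose D : {mpoly int[a + b]} := S * \det (\matrix_(j < b, i < b) 'X_[ey i] ^+ rev_ord j).
rewrite (eq_shift_prod _ (fun u => shift_prod_pairs ey S u)).
rewrite [LHS](shift_prod_translate (fun u => laurent_coef u D)) shift_prod_pairs_sum.
apply: eq_bigr => s _; rewrite (laurent_coef_monomial_det ey (fun j => rev_ord j)) mulr_sumr.
apply: eq_bigr => t _; congr (_ * (_ * laurent_coef _ _)).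
rewrite !sum_mvec_ex !sum_mvec_ey /joinv /= !(opp_row_mx, add_row_mx, oppr0, addr0).
by congr row_mx; apply/rowP => i; rewrite !mxE.
Qed.

(** Expanding the [phi] of [mu] and [nu] produces products of two [psi], each a single [wpsi] by
    [wpsi_box]. Their pairing with the [phi] of [la] is a coefficient of [S]. *)
Lemma kron_shift_prod (mu nu : seq nat) :
  sumn mu = n -> sumn nu = n -> sorted geq mu -> sorted geq nu ->
  (size mu <= a)%N -> (size nu <= b)%N ->
  (kron la mu nu)%:Z = shift_prod (row_weights a b ++ col_weights a b) c (vec a mu, vec b nu).
Proof.
move=> mu_n nu_n mus nus mua nub; rewrite shift_prod_row_col_weights.
have n0 : n`!%:R != 0 :> algC by rewrite pnatr_eq0 -lt0n fact_gt0.
apply: (@intr_inj algC); apply: (mulfI n0).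
rewrite -pmulrn (kron_phi la_n mu_n nu_n la_sorted mus nus la_size mua nub).
have sgnE (p q r s t : algC) : p * ((s * q) * (t * r)) = s * (t * (p * (q * r))) by ring.
rewrite (eq_bigr (fun g => \sum_(s : 'S_a) \sum_(t : 'S_b) (-1) ^+ s * ((-1) ^+ t *
   (phi m g * (psi (fun i : 'I_a => (nth 0%N mu i + rev_ord i)%N%:Z - (rev_ord (s i))%:Z) g *
               psi (fun j : 'I_b => (nth 0%N nu j + rev_ord j)%N%:Z - (rev_ord (t j))%:Z) g))))); last first.
  move=> g _; rewrite -mulrA -/m {2 3}/phi big_distrlr mulr_sumr; apply: eq_bigr => s _.
  by rewrite mulr_sumr; apply: eq_bigr => t _; exact: sgnE.
rewrite exchange_big rmorph_sum mulr_sumr; apply: eq_bigr => s _ /=.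
rewrite exchange_big rmorph_sum mulr_sumr; apply: eq_bigr => t _ /=.
rewrite rmorphM rmorphM !rmorph_sign.
rewrite [RHS]mulrCA [_ * (_ * _%:~R)]mulrCA -frobenius_phi ?leq_addr //; last first.
  exact: exponent_sum.
rewrite !mulr_sumr; apply: eq_bigr => g _; rewrite wpsi_box.
by congr (_ * (_ * (_ * (_ * _)))); apply: eq_psi => i; rewrite !mxE PoszD.
Qed.

Lemma shift_source_finite : exists r : seq ('rV[int]_a * 'rV[int]_b),
  forall u, u \notin r -> c u = 0.
Proof.
have [r Hr] := laurent_coef_finite S.
exists [seq (lsubmx u, rsubmx u) | u <- r] => u ur; apply: Hr; apply: contra ur => ur.
by apply/mapP; exists (joinv u) => //; rewrite /joinv row_mxKl row_mxKr; case: u {ur}.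
Qed.

(** What the rest of the proof retains of [S]: finite support, the Weyl numerator obtained from all
    box weights, and the link with [kron]. *)
Lemma kron_source : exists c : 'rV[int]_a * 'rV[int]_b -> int,
  [/\ exists r : seq ('rV[int]_a * 'rV[int]_b), forall u, u \notin r -> c u = 0,
     forall v, shift_prod (box_weights T) c v = \sum_(s : 'S_(a * b)) (-1) ^+ s *
       (v + \sum_p (delta_mx 0 (box p).1, delta_mx 0 (box p).2) *+ rev_ord p ==
        \sum_p (delta_mx 0 (box p).1, delta_mx 0 (box p).2) *+
          (nth 0%N la (s p) + rev_ord (s p)))%:R &
     forall mu nu, sumn mu = n -> sumn nu = n -> sorted geq mu -> sorted geq nu ->
       (size mu <= a)%N -> (size nu <= b)%N ->
       (kron la mu nu)%:Z =
       shift_prod (row_weights a b ++ col_weights a b) c (vec a mu, vec b nu)].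
Proof.
exists c; split.
- exact: shift_source_finite.
- move=> v; by rewrite shift_prod_box_weights.
- move=> mu nu h1 h2 h3 h4 h5 h6; exact: kron_shift_prod.
Qed.
End Boxes.

(** * Inversion and rearrangement *)

Lemma sum_ffunS (k B : nat) (F : 'I_B -> {ffun 'I_k -> 'I_B} -> int) :
  \sum_(t : {ffun 'I_k.+1 -> 'I_B}) F (t ord0) [ffun i => t (lift ord0 i)] =
  \sum_(f : {ffun 'I_k -> 'I_B}) \sum_j F j f.
Proof.
rewrite exchange_big pair_bigA /=.
pose h (p : 'I_B * {ffun 'I_k -> 'I_B}) : {ffun 'I_k.+1 -> 'I_B} :=
  [ffun i => if unlift ord0 i is Some i' then p.2 i' else p.1].
have h0 p : h p ord0 = p.1 by rewrite ffunE unlift_none.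
have hl p i : h p (lift ord0 i) = p.2 i by rewrite ffunE liftK.
rewrite (reindex h).
  apply: eq_bigr => p _; rewrite h0; congr F.
  by apply/ffunP => i; rewrite ffunE hl.
exists (fun t : {ffun 'I_k.+1 -> 'I_B} => (t ord0, [ffun i => t (lift ord0 i)])) => [p _|t _].
  by rewrite h0; case: p => j f; congr (_, _); apply/ffunP => i; rewrite ffunE hl.
apply/ffunP => i; rewrite ffunE; case: unliftP => [i' ->|->] //=.
by rewrite ffunE.
Qed.

Section Inversion.
Variables (R : realDomainType) (V : zmodType) (l : {additive V -> R}) (c : V -> int) (b0 : R).
Hypothesis c0 : forall v, l v < b0 -> c v = 0.

Lemma shift_prod_eq0 W v : {in W, forall w, 0 < l w} -> l v < b0 -> shift_prod W c v = 0.
Proof.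
elim: W v => [|w W IH] v W0 lv /=; first exact: c0.
have W0' : {in W, forall w, 0 < l w} by move=> u uW; apply: W0; rewrite inE uW orbT.
rewrite /shift_diff !IH ?subrr // raddfB /= (lt_trans _ lv) // gtrBl.
by apply: W0; rewrite mem_head.
Qed.

Lemma shift_diff_sum (c' : V -> int) w B v :
  \sum_(j < B) shift_diff w c' (v - w *+ j) = c' v - c' (v - w *+ B).
Proof.
elim: B => [|B IH]; first by rewrite big_ord0 mulr0n subr0 subrr.
rewrite big_ord_recr /= IH /shift_diff mulrSr opprD [v + (_ + _)]addrA.
ring.
Qed.

(** The inverse of [1 - shift] is a geometric series of shifts. Telescoping at each weight leaves an
    end term shifted [B] times, which is zero because it falls below the bound [b0]. *)
Lemma shift_prod_inversion W B v : {in W, forall w, 0 < l w} ->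
  {in W, forall w, l v - l w *+ B < b0} ->
  c v = \sum_(t : {ffun 'I_(size W) -> 'I_B}) shift_prod W c (v - \sum_(i < size W) nth 0 W i *+ t i).
Proof.
elim: W v => [|w W IH] v W0 WB /=.
  under eq_bigr do rewrite big_ord0 subr0.
  by rewrite sumr_const card_ffun !card_ord expn0.
have W0' : {in W, forall w, 0 < l w} by move=> u uW; apply: W0; rewrite inE uW orbT.
have w0 : 0 < l w by apply: W0; rewrite mem_head.
rewrite IH // => [|u uW]; last by apply: WB; rewrite inE uW orbT.
transitivity (\sum_(f : {ffun 'I_(size W) -> 'I_B}) \sum_(j < B)
   shift_diff w (shift_prod W c) (v - \sum_(i < size W) nth 0 W i *+ f i - w *+ j)).
  apply: eq_bigr => f _; rewrite shift_diff_sum (shift_prod_eq0 (v := _ - w *+ B)) ?subr0 //.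
  rewrite raddfB raddfB /= raddfMn; apply: le_lt_trans (WB w (mem_head _ _)).
  rewrite lerD2r gerBl raddf_sum sumr_ge0 // => i _.
  by rewrite raddfMn /= mulrn_wge0 // ltW // W0' // mem_nth.
rewrite -(sum_ffunS (fun j f => shift_diff w (shift_prod W c) (v - \sum_(i < size W) nth 0 W i *+ f i - w *+ j))).
apply: eq_bigr => t _; congr (shift_diff _ _ _).
rewrite big_ord_recl /= opprD addrA [RHS]addrAC; congr (_ - _ - _).
by apply: eq_bigr => i _; rewrite ffunE.
Qed.
End Inversion.

Section Rearrangement.
Variables (R : realDomainType) (N : nat) (u v : 'I_N -> R).
Hypotheses (u_inc : forall i j : 'I_N, (i < j)%N -> u i < u j)
           (v_dec : forall i j : 'I_N, (i < j)%N -> v j < v i).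

Lemma perm_sum_descent (s : 'S_N) : s != 1%g ->
  exists t : 'S_N, \sum_i u i * v (t i) < \sum_i u i * v (s i).
Proof.
move=> /perm_lt_moved[i [isi fixi]].
pose j := (s^-1 i)%g; have sj : s j = i by rewrite /j permKV.
have nji : j != i by apply/eqP => E; rewrite -{1}sj E ltnn in isi.
have ij : (i < j)%N.
  rewrite ltn_neqAle eq_sym (inj_eq val_inj) nji leqNgt; apply/negP => ji.
  by move: nji; rewrite -(fixi j ji) sj eqxx.
exists (tperm i j * s)%g.
rewrite (bigD1 i) // (bigD1 j) //= [ltRHS](bigD1 i) // [X in _ < _ + X](bigD1 j) //=.
rewrite !permM tpermL tpermR sj (eq_bigr (fun p => u p * v (s p))) => [|p /andP[pi pj]]; last first.
  by rewrite permM tpermD // eq_sym.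
rewrite !addrA ltrD2r.
have := u_inc ij; have := v_dec isi; rewrite -subr_gt0 => h1; rewrite -subr_gt0 => h2.
(* The exchange lowers the sum by [(u j - u i) * (v i - v (s i))]. *)
rewrite -subr_gt0; have := mulr_gt0 h1 h2; congr (0 < _); ring.
Qed.

(** A minimum over the finite group exists, and by the descent it can only be at the identity; one
    descent step from [s] makes the inequality strict. *)
Lemma rearrangement_lt (s : 'S_N) : s != 1%g ->
  \sum_i u i * v i < \sum_i u i * v (s i).
Proof.
move=> s1; have [t ts] := perm_sum_descent s1.
pose F (s : 'S_N) := \sum_i u i * v (s i).
have [s0 _ min] := @Order.TotalTheory.arg_minP _ _ _ (1%g : 'S_N) xpredT F isT.
have s01 : s0 = 1%g.
  apply/eqP/negPn/negP => /perm_sum_descent[t'].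
  by rewrite ltNge => /negP; apply; apply: min.
have -> : \sum_i u i * v i = F 1%g by apply: eq_bigr => i _; rewrite perm1.
by rewrite -s01 (le_lt_trans (min t isT)).
Qed.
End Rearrangement.

Lemma nth_part_add s t i : nth 0%N (part_add s t) i = (nth 0%N s i + nth 0%N t i)%N.
Proof.
have [im|mi] := ltnP i (maxn (size s) (size t)); first by rewrite nth_mkseq.
by rewrite !nth_default ?size_mkseq //; move: mi; rewrite geq_max => /andP[].
Qed.

Lemma nth_part_scale k s i : nth 0%N (part_scale k s) i = (k * nth 0%N s i)%N.
Proof.
have [im|mi] := ltnP i (size s); first by rewrite (nth_map 0%N).
by rewrite !nth_default ?size_map // muln0.
Qed.

Lemma sorted_geqP s : (forall i j, (i <= j)%N -> (nth 0 s j <= nth 0 s i)%N) -> sorted geq s.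
Proof. by move=> H; apply/(sortedP 0%N) => i _; apply: H. Qed.

Lemma nth_aT a b (T : 'I_a * 'I_b -> 'I_(a * b)) la (i : 'I_a) :
  nth 0%N (aT T la) i = (\sum_(j < b) nth 0 la (T (i, j)))%N.
Proof. by rewrite (nth_map i) ?size_enum_ord // nth_ord_enum. Qed.

Lemma nth_bT a b (T : 'I_a * 'I_b -> 'I_(a * b)) la (j : 'I_b) :
  nth 0%N (bT T la) j = (\sum_(i < a) nth 0 la (T (i, j)))%N.
Proof. by rewrite (nth_map j) ?size_enum_ord // nth_ord_enum. Qed.

Lemma size_part_add s t : size (part_add s t) = maxn (size s) (size t).
Proof. by rewrite size_mkseq. Qed.

(* Only imported here: these notations clash with those of [mpoly]. *)
From mathcomp Require Import classical_sets functions cardinality reals.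

(** * Integral points *)

Lemma arch_seq (R : archiRealFieldType) (s : seq R) (C : R) : {in s, forall z, 0 < z} ->
  exists K, forall k, (K <= k)%N -> {in s, forall z, C < z *+ k}.
Proof.
elim: s => [|z s IH] s0; first by exists 0%N => k _ u; rewrite in_nil.
have [u us|K HK] := IH; first by apply: s0; rewrite inE us orbT.
have z0 : 0 < z by apply: s0; rewrite mem_head.
exists (maxn K (Num.bound (`|C| / z))) => k; rewrite geq_max => /andP[Kk zk] u.
rewrite inE => /orP[/eqP->|]; last exact: HK.
rewrite -mulr_natl -ltr_pdivrMr //.
apply: (@le_lt_trans _ _ (`|C| / z)); first by rewrite ler_pM2r ?invr_gt0 ?ler_norm.
apply: (lt_le_trans (archi_boundP _)); first by rewrite divr_ge0 // ltW.
by rewrite ler_nat.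
Qed.

Lemma fst_sumMn (I : finType) (U V : zmodType) (F : I -> U * V) (k : I -> nat) :
  (\sum_i F i *+ k i).1 = \sum_i (F i).1 *+ k i.
Proof.
rewrite (big_morph (fun u : U * V => u.1) (id1 := 0) (op1 := +%R)) //.
by apply: eq_bigr => i _; elim: (k i) => // j IH; rewrite !mulrS -IH.
Qed.

Lemma snd_sumMn (I : finType) (U V : zmodType) (F : I -> U * V) (k : I -> nat) :
  (\sum_i F i *+ k i).2 = \sum_i (F i).2 *+ k i.
Proof.
rewrite (big_morph (fun u : U * V => u.2) (id1 := 0) (op1 := +%R)) //.
by apply: eq_bigr => i _; elim: (k i) => // j IH; rewrite !mulrS -IH.
Qed.

Section Points.
Variables (R : realType) (a b : nat) (T : 'I_a * 'I_b -> 'I_(a * b)).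
Variables (mu : 'rV[int]_a) (nu : 'rV[int]_b).
Let M := size (weights T).

Definition solutions B : {set {ffun 'I_M -> 'I_B}} :=
  [set t : {ffun 'I_M -> 'I_B} | \sum_(i < M) nth 0 (weights T) i *+ (t i : nat) == (mu, nu)].

Lemma polytope_natE (t : 'I_M -> nat) :
  polytope R T mu nu (\row_i (t i)%:R) <->
  \sum_(i < M) nth 0 (weights T) i *+ t i = (mu, nu).
Proof.
have E m (f : 'I_M -> 'rV[int]_m) (p : 'rV[int]_m) :
    \sum_(i < M) (\row_i (t i)%:R : 'rV[R]_M) 0 i *: map_mx intr (f i) = map_mx intr p <->
    \sum_i f i *+ t i = p.
  have -> : \sum_(i < M) (\row_i (t i)%:R : 'rV[R]_M) 0 i *: map_mx intr (f i) =
      map_mx intr (\sum_i f i *+ t i).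
    rewrite raddf_sum; apply: eq_bigr => i _; rewrite mxE scaler_nat.
    by rewrite raddfMn.
  split=> [/matrixP H|->//]; apply/matrixP => i j.
  by have := H i j; rewrite !mxE => /intr_inj.
rewrite /polytope /=; split=> [[_ /E h1 /E h2]|h].
  by rewrite [LHS]surjective_pairing fst_sumMn snd_sumMn h1 h2.
split=> [i||]; first by rewrite mxE ler0n.
  by apply/E; rewrite -fst_sumMn h.
by apply/E; rewrite -snd_sumMn h.
Qed.

(** Integral points have natural coordinates, all less than [B] by hypothesis, so they correspond to
    the elements of [solutions B]. *)
Lemma card_integral_points B :
  (forall t : 'I_M -> nat, \sum_(i < M) nth 0 (weights T) i *+ t i = (mu, nu) ->
     forall i, (t i < B)%N) ->
  (integral_points (polytope R T mu nu) #= `I_#|solutions B|)%card.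
Proof.
move=> bnd.
pose f (k : 'I_#|solutions B|) : 'rV[R]_M := \row_i (enum_val k i : nat)%:R.
have fI : injective f.
  move=> k k' /rowP E; apply: enum_val_inj; apply/ffunP => i; apply: val_inj.
  by have := E i; rewrite !mxE => /eqP; rewrite eqr_nat => /eqP.
have -> : integral_points (polytope R T mu nu) = (f @` [set: 'I_#|solutions B|])%classic.
  apply/seteqP; split=> t /=.
    move=> [Pt tint]; have t0 i : 0 <= t 0 i by case: Pt.
    have tE : t = \row_i (Num.truncn (t 0 i))%:R.
      by apply/rowP => i; rewrite mxE truncnK // natrEint tint t0.
    have S := (polytope_natE (fun i => Num.truncn (t 0 i))).1; rewrite -tE in S.
    have {}S := S Pt.
    have tB := bnd _ S.
    pose g : {ffun 'I_M -> 'I_B} := [ffun i => Ordinal (tB i)].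
    have gS : g \in solutions B.
      by rewrite inE; apply/eqP; rewrite -[RHS]S; apply: eq_bigr => i _; rewrite ffunE.
    exists (enum_rank_in gS g) => //.
    by rewrite [RHS]tE; apply/rowP => i; rewrite !mxE enum_rankK_in // ffunE.
  move=> [k _ <-]; split; last by move=> i; rewrite mxE natr_int.
  by apply/polytope_natE; have := enum_valP k; rewrite inE => /eqP.
apply: (card_eq_trans (inj_card_eq _) (card_esym card_II)).
by move=> k k' _ _; apply: fI.
Qed.
End Points.

(** * The leading term *)

Section Functional.
Variables (R : realType) (a b : nat) (x : 'I_a -> R) (y : 'I_b -> R).

(** The functional given by additivity: it takes the value [x i + y j] on the vector of box
    [(i, j)], hence is positive on all box weights. *)
Definition pairing (u : 'rV[int]_a * 'rV[int]_b) : R :=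
  \sum_i x i * (u.1 0 i)%:~R + \sum_j y j * (u.2 0 j)%:~R.

Lemma pairing_is_additive : zmod_morphism pairing.
Proof.
move=> u v; rewrite /pairing opprD addrACA -!sumrB.
by congr (_ + _); apply: eq_bigr => i _; rewrite !mxE intrB mulrBr.
Qed.

HB.instance Definition _ :=
  GRing.isZmodMorphism.Build ('rV[int]_a * 'rV[int]_b)%type R pairing pairing_is_additive.

Lemma pairing_delta i j : pairing (delta_mx 0 i, delta_mx 0 j) = x i + y j.
Proof.
have E m (z : 'I_m -> R) (k : 'I_m) : \sum_i z i * ((delta_mx 0 k : 'rV[int]_m) 0 i)%:~R = z k.
  rewrite (bigD1 k) //= big1 ?addr0 => [|l /negPf lk]; first by rewrite mxE !eqxx mulr1.
  by rewrite mxE lk andbF mulr0.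
by rewrite /pairing !E.
Qed.
End Functional.

Section Main.
Variables (R : realType) (a b : nat) (T : 'I_a * 'I_b -> 'I_(a * b)).
Hypotheses (a0 : (0 < a)%N) (b0 : (0 < b)%N) (sT : standard_tableau T).
Variables (x : 'I_a -> R) (y : 'I_b -> R).
Hypothesis xyT : forall (i k : 'I_a) (j l : 'I_b),
  (T (i, j) < T (k, l))%N <-> x i + y j < x k + y l.
Let l : {additive 'rV[int]_a * 'rV[int]_b -> R} := pairing x y.

Lemma pairing_box_weights : {in box_weights T, forall w, 0 < l w}.
Proof.
move=> w /mapP[[[i j] [k m]] + ->]; rewrite mem_filter => /andP[/= /xyT lt _].
have -> : (delta_mx 0 k - delta_mx 0 i, delta_mx 0 m - delta_mx 0 j) =
   (delta_mx 0 k, delta_mx 0 m) - (delta_mx 0 i, delta_mx 0 j) :> 'rV[int]_a * 'rV[int]_b by [].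
by rewrite raddfB /= !pairing_delta subr_gt0.
Qed.

Lemma mem_box_weights w :
  w \in (row_weights a b ++ col_weights a b) ++ weights T -> w \in box_weights T.
Proof. by rewrite (perm_mem (perm_weights a0 b0 sT)). Qed.

Lemma pairing_weights : {in weights T, forall w, 0 < l w}.
Proof.
by move=> w wW; apply: pairing_box_weights; apply: mem_box_weights; rewrite mem_cat wW orbT.
Qed.

(** Each term [t i] times the positive value of [l] at its weight is at most [l v]. *)
Lemma solution_bound (v : 'rV[int]_a * 'rV[int]_b) : exists B, forall t : 'I_(size (weights T)) -> nat,
  \sum_(i < size (weights T)) nth 0 (weights T) i *+ t i = v -> forall i, (t i < B)%N.
Proof.
have [z|B HB] := @arch_seq R [seq l w | w <- weights T] (l v).
  by move=> /mapP[w wW ->]; apply: pairing_weights.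
exists B => t tv i; rewrite ltnNge; apply/negP => /HB/(_ (l (nth 0 (weights T) i))).
rewrite map_f ?mem_nth // -tv => /(_ isT); apply/negP; rewrite -leNgt.
rewrite raddf_sum (bigD1 i) //= raddfMn lerDl sumr_ge0 // => j _.
by rewrite raddfMn mulrn_wge0 // ltW // pairing_weights // mem_nth.
Qed.

Section Count.
Variables (box : 'I_(a * b) -> 'I_a * 'I_b).
Hypotheses (TK : cancel T box) (boxK : cancel box T).
Let w (p : 'I_(a * b)) : 'rV[int]_a * 'rV[int]_b := (delta_mx 0 (box p).1, delta_mx 0 (box p).2).

Lemma sum_boxes la : \sum_p w p *+ nth 0%N la p = (vec a (aT T la), vec b (bT T la)).
Proof.
rewrite [LHS]surjective_pairing fst_sumMn snd_sumMn /=.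
have delta_sum m (k : 'I_(a * b) -> 'I_m) (i : 'I_m) :
    (\sum_p delta_mx 0 (k p) *+ nth 0%N la p : 'rV[int]_m) 0 i =
    (\sum_(p | k p == i) nth 0%N la p)%N%:Z.
  rewrite summxE (big_morph Posz PoszD (erefl _)) [RHS]big_mkcond; apply: eq_bigr => p _.
  rewrite mulmxnE mxE eqxx /= eq_sym; case: eqP => _; last by rewrite mul0rn.
  by rewrite mulr1n natz.
have boxT (P : pred ('I_a * 'I_b)) (F : 'I_(a * b) -> nat) :
    (\sum_(p | P (box p)) F p = \sum_(q | P q) F (T q))%N.
  rewrite (reindex T) /=; last by exists box => ? _.
  by apply: eq_bigl => q; rewrite TK.
congr (_, _); apply/rowP => i; rewrite delta_sum mxE.
  rewrite (boxT (fun q => q.1 == i)) nth_aT; congr Posz.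
  transitivity (\sum_(k | k == i) \sum_j nth 0 la (T (k, j)))%N; last by rewrite big_pred1_eq.
  by rewrite pair_big; apply: eq_big => [q|[k j] _] //; rewrite andbT.
rewrite (boxT (fun q => q.2 == i)) nth_bT; congr Posz.
transitivity (\sum_k \sum_(j | j == i) nth 0 la (T (k, j)))%N.
  by rewrite pair_big; apply: eq_bigr => -[].
by apply: eq_bigr => k _; rewrite big_pred1_eq.
Qed.

(** Inverting the operators of [weights T] gives a sum over [t] of the box-weight product, an
    alternating sum of deltas. The identity contributes 1 exactly when [t] is a solution; the
    hypothesis on [s] excludes the other terms. *)
Lemma kron_count n la mu nu B1 :
  sumn la = n -> sorted geq la -> (size la <= a * b)%N ->
  sumn mu = n -> sumn nu = n -> sorted geq mu -> sorted geq nu ->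
  (size mu <= a)%N -> (size nu <= b)%N ->
  (forall s : 'S_(a * b), s != 1%g ->
     l (vec a mu, vec b nu) + l (\sum_p w p *+ rev_ord p) <
     l (\sum_p w p *+ (nth 0%N la (s p) + rev_ord (s p)))) ->
  exists2 B, (B1 <= B)%N & kron la mu nu =
    #|solutions T (vec a mu - vec a (aT T la)) (vec b nu - vec b (bT T la)) B|.
Proof.
move=> la_n las laN mu_n nu_n mus nus mua nub far.
have [c [[r cr] cbox ckron]] := kron_source TK boxK la_n las laN.
set v := (vec a mu, vec b nu) in far *.
pose c' := shift_prod (row_weights a b ++ col_weights a b) c.
(* A lower bound for [l] on the finite support of [c]. *)
pose m0 := - \sum_(u <- r) `|l u|.
have c0 u : l u < m0 -> c u = 0.
  move=> lu; apply: cr; apply: contraTN lu => ur; rewrite -leNgt /m0 lerNl.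
  rewrite (perm_big _ (perm_to_rem ur)) big_cons /=.
  apply: (le_trans (y := `|l u|)); first by rewrite -normrN ler_norm.
  by rewrite lerDl sumr_ge0.
have c'0 u : l u < m0 -> c' u = 0.
  apply: shift_prod_eq0 => // z zr; apply: pairing_box_weights.
  by apply: mem_box_weights; rewrite mem_cat zr.
have [z|B HB] := @arch_seq R [seq l w | w <- weights T] (l v - m0).
  by move=> /mapP[z' zW ->]; apply: pairing_weights.
exists (maxn B1 B); first exact: leq_maxl.
set B2 := maxn _ _.
have HB2 : {in weights T, forall z, l v - l z *+ B2 < m0}.
  by move=> z zW; have := HB B2 (leq_maxr _ _) _ (map_f l zW); rewrite ltrBlDr ltrBlDl addrC.
have : (kron la mu nu)%:Z = #|solutions T (vec a mu - vec a (aT T la)) (vec b nu - vec b (bT T la)) B2|%:Z.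
  rewrite ckron // -/c' -/v (shift_prod_inversion c'0 pairing_weights HB2).
  rewrite -sum1dep_card (big_morph Posz PoszD (erefl _)) [RHS]big_mkcond; apply: eq_bigr => t _.
  set W := \sum_(i < _) _.
  have -> : shift_prod (weights T) c' (v - W) = shift_prod (box_weights T) c (v - W).
    rewrite -shift_prod_cat; apply: shift_prod_perm; rewrite perm_sym.
    by rewrite (perm_trans (perm_weights a0 b0 sT)) // perm_catC.
  have lW : 0 <= l W.
    rewrite raddf_sum sumr_ge0 // => i _.
    by rewrite raddfMn mulrn_wge0 // ltW // pairing_weights // mem_nth.
  rewrite cbox (bigD1 (1%g : 'S_(a * b))) //= odd_perm1 mul1r [X in _ + X]big1 => [|s s1].
    have -> : \sum_p (delta_mx 0 (box p).1, delta_mx 0 (box p).2) *+ (nth 0%N la ((1%g : 'S_(a * b)) p) + rev_ord ((1%g : 'S_(a * b)) p)) =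
        (vec a (aT T la), vec b (bT T la)) + \sum_p w p *+ rev_ord p.
      by rewrite -sum_boxes -big_split; apply: eq_bigr => p _; rewrite perm1 mulrnDr.
    rewrite (inj_eq (addIr _)) addr0 subr_eq addrC -subr_eq.
    have -> : v - (vec a (aT T la), vec b (bT T la)) =
       (vec a mu - vec a (aT T la), vec b nu - vec b (bT T la)) by [].
    by rewrite eq_sym; case: eqP.
  (* Applying [l] to such an equality would, by [far], make [l W] negative. *)
  case: eqP => [E|]; last by rewrite mulr0.
  have := far s s1; rewrite -[X in _ < l X]E !raddfD raddfN /= -subr_gt0.
  by move=> H; exfalso; move: H; rewrite -raddfD; lra.
by case.
Qed.

Lemma eventually_far (la al : 'I_(a * b) -> nat) (v : 'rV[int]_a * 'rV[int]_b) :
  (forall p q : 'I_(a * b), (p < q)%N -> (la q < la p)%N) ->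
  exists K, forall k, (K <= k)%N -> forall s : 'S_(a * b), s != 1%g ->
    l (v + (\sum_p w p *+ la p) *+ k) + l (\sum_p w p *+ rev_ord p) <
    l (\sum_p w p *+ (al (s p) + k * la (s p) + rev_ord (s p))).
Proof.
move=> la_dec.
pose D (s : 'S_(a * b)) := \sum_p l (w p) * (la (s p))%:R - \sum_p l (w p) * (la p)%:R.
pose C (s : 'S_(a * b)) := l v + l (\sum_p w p *+ rev_ord p) -
  l (\sum_p w p *+ (al (s p) + rev_ord (s p))).
have u_inc (p q : 'I_(a * b)) : (p < q)%N -> l (w p) < l (w q).
  move=> pq; rewrite /l /= !pairing_delta; apply/xyT.
  by rewrite -!surjective_pairing !boxK.
(* By rearrangement [D s] is positive, so [D s *+ k] outgrows [C s], which does not depend on [k];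
   the sum of all [|C s|] serves every [s] at once. *)
have [z|K HK] := @arch_seq R [seq D s | s <- enum (predC1 (1%g : 'S_(a * b)))] (\sum_s `|C s|).
  move=> /mapP[s]; rewrite mem_enum => s1 ->; rewrite subr_gt0.
  by apply: (rearrangement_lt u_inc (v := fun p => (la p)%:R)) => // p q pq; rewrite ltr_nat la_dec.
exists K => k Kk s s1.
have CD : C s < D s *+ k.
  have sD : D s \in [seq D s | s <- enum (predC1 (1%g : 'S_(a * b)))] by rewrite map_f ?mem_enum.
  apply: le_lt_trans (HK k Kk (D s) sD).
  rewrite (bigD1 s) //= (le_trans (ler_norm _)) // lerDl sumr_ge0 //.
have lsum (f : 'I_(a * b) -> nat) : l (\sum_p w p *+ f p) = \sum_p l (w p) * (f p)%:R.
  by rewrite raddf_sum; apply: eq_bigr => p _; rewrite raddfMn mulr_natr.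
rewrite raddfD raddfMn.
have -> : l (\sum_p w p *+ (al (s p) + k * la (s p) + rev_ord (s p))) =
    l (\sum_p w p *+ (al (s p) + rev_ord (s p))) + (\sum_p l (w p) * (la (s p))%:R) *+ k.
  rewrite !lsum -sumrMnl -big_split; apply: eq_bigr => p _ /=.
  by rewrite -mulr_natr !natrD natrM; ring.
move: CD; rewrite /C /D mulrnBl -!lsum.
move: (l (\sum_p w p *+ la p) *+ k) (l (\sum_p w p *+ la (s p)) *+ k) => A1 A2; lra.
Qed.
End Count.
End Main.

(** * Sums of partitions and the stable value *)

Lemma sumn_part_add N s t : (size s <= N)%N -> (size t <= N)%N ->
  sumn (part_add s t) = (sumn s + sumn t)%N.
Proof.
move=> sN tN; rewrite -(part_sum (erefl (sumn s)) sN) -(part_sum (erefl (sumn t)) tN).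
rewrite -(@part_sum _ N (part_add s t) (erefl _)) ?size_part_add ?geq_max ?sN //.
by rewrite -big_split; apply: eq_bigr => i _; rewrite nth_part_add.
Qed.

Lemma size_part_scale k s : size (part_scale k s) = size s.
Proof. exact: size_map. Qed.

Lemma sumn_part_scale k s : sumn (part_scale k s) = (k * sumn s)%N.
Proof. by rewrite !sumnE big_map big_distrr. Qed.

Lemma vec_part_add m s t k : vec m (part_add s (part_scale k t)) = vec m s + vec m t *+ k.
Proof.
by apply/rowP => i; rewrite !mxE mulmxnE mxE nth_part_add nth_part_scale PoszD PoszM -mulr_natl natz.
Qed.

Lemma sorted_part_add s t : sorted geq s -> sorted geq t -> sorted geq (part_add s t).
Proof.
move=> ss st; apply: sorted_geqP => i j ij; rewrite !nth_part_add.
by rewrite leq_add ?(nth_part ss ij) ?(nth_part st ij).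
Qed.

Lemma sorted_part_scale k s : sorted geq s -> sorted geq (part_scale k s).
Proof.
move=> ss; apply: sorted_geqP => i j ij; rewrite !nth_part_scale.
by rewrite leq_mul2l (nth_part ss ij) orbT.
Qed.

(** With [N - 1] parts, the last entry is read as the default 0, still less than the positive part
    before it. *)
Lemma strict_part_lt N la i j : is_part la -> sorted gtn la ->
  (size la = N \/ size la = N - 1)%N -> (i < j < N)%N -> (nth 0 la j < nth 0 la i)%N.
Proof.
move=> /andP[_ la0] las szl /andP[ij jN].
have [jl|lj] := ltnP j (size la).
  have T : transitive gtn by move=> p q r /= h1 h2; exact: ltn_trans h2 h1.
  by apply: (sorted_ltn_nth T 0%N las) => //; rewrite inE // (ltn_trans ij).
rewrite (nth_default _ lj) lt0n; apply: contraNneq la0 => <-.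
apply: mem_nth; case: szl => szl; move: lj; rewrite szl => lj; lia.
Qed.

(** This rules out integral points when the sizes of [al], [be], [ga] differ. *)
Lemma sum_coord_box_weights a b (T : 'I_a * 'I_b -> 'I_(a * b)) w : w \in box_weights T ->
  \sum_i w.1 0 i = 0 /\ \sum_j w.2 0 j = 0.
Proof.
move=> /mapP[[[i j] [k m]] _ ->] /=.
have E d (p q : 'I_d) : \sum_r (delta_mx 0 p - delta_mx 0 q : 'rV[int]_d) 0 r = 0.
  have D (c : 'I_d) : \sum_r (delta_mx 0 c : 'rV[int]_d) 0 r = 1.
    rewrite (bigD1 c) //= big1 ?addr0 => [|r /negPf rc]; first by rewrite mxE !eqxx.
    by rewrite mxE rc andbF.
  transitivity (\sum_r (delta_mx 0 p : 'rV[int]_d) 0 r - \sum_r (delta_mx 0 q : 'rV[int]_d) 0 r).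
    by rewrite -sumrB; apply: eq_bigr => r _; rewrite !mxE.
  by rewrite !D subrr.
by rewrite !E.
Qed.

Theorem proposition8 (R : realType) (a b : nat) (T : 'I_a * 'I_b -> 'I_(a * b))
    (la al be ga : seq nat) :
  (1 <= a)%N -> (1 <= b)%N ->
  standard_tableau T -> additive_tableau R T ->
  is_part la -> sorted gtn la ->
  (size la = a * b \/ size la = a * b - 1)%N ->
  is_part al -> (size al <= a * b)%N ->
  is_part be -> (size be <= a)%N ->
  is_part ga -> (size ga <= b)%N ->
  exists2 g : nat, is_reduced_kron T la al be ga g &
    (integral_points
       (polytope R T (vec a be - vec a (aT T al)) (vec b ga - vec b (bT T al)))
     #= `I_g)%card.
Proof.
move=> a0 b0 sT [x [y [_ _ xyT]]] la_part la_strict la_size /andP[als _] alN /andP[bes _] bea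
  /andP[gas _] gab.
have [[box TK boxK] Trow Tcol] := sT.
have laN : (size la <= a * b)%N by case: la_size => ->; rewrite ?leq_subr.
have las : sorted geq la by case/andP: la_part.
set mu0 := vec a be - _; set nu0 := vec b ga - _.
have [B1 HB1] := solution_bound a0 b0 sT xyT (mu0, nu0).
exists #|solutions T mu0 nu0 B1|; last exact: card_integral_points.
have sz_aT s : size (aT T s) = a by rewrite size_map size_enum_ord.
have sz_bT s : size (bT T s) = b by rewrite size_map size_enum_ord.
have sum_aT s : (size s <= a * b)%N -> sumn (aT T s) = sumn s.
  move=> sN; rewrite -(@part_sum _ a (aT T s) (erefl _)) ?sz_aT // -(part_sum (erefl (sumn s)) sN).
  under eq_bigr do rewrite nth_aT.
  rewrite pair_bigA [RHS](reindex T) /=; last by exists box => ? _.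
  by apply: eq_bigr => -[].
have sum_bT s : (size s <= a * b)%N -> sumn (bT T s) = sumn s.
  move=> sN; rewrite -(@part_sum _ b (bT T s) (erefl _)) ?sz_bT // -(part_sum (erefl (sumn s)) sN).
  under eq_bigr do rewrite nth_bT.
  rewrite exchange_big pair_bigA [RHS](reindex T) /=; last by exists box => ? _.
  by apply: eq_bigr => -[].
have sorted_aT s : sorted geq s -> sorted geq (aT T s).
  move=> ss; apply: sorted_geqP => i j ij.
  have [ja|aj] := ltnP j a; last by rewrite nth_default ?sz_aT.
  pose i' := Ordinal (leq_ltn_trans ij ja); pose j' := Ordinal ja.
  rewrite -[i]/(val i') -[j]/(val j') !nth_aT; apply: leq_sum => r _; apply: (nth_part ss).
  by have := ij; rewrite leq_eqVlt => /orP[/eqP E|/(Tcol i' j' r)/ltnW//]; rewrite (_ : i' = j') //; apply: val_inj.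
have sorted_bT s : sorted geq s -> sorted geq (bT T s).
  move=> ss; apply: sorted_geqP => i j ij.
  have [jb|bj] := ltnP j b; last by rewrite nth_default ?sz_bT.
  pose i' := Ordinal (leq_ltn_trans ij jb); pose j' := Ordinal jb.
  rewrite -[i]/(val i') -[j]/(val j') !nth_bT; apply: leq_sum => r _; apply: (nth_part ss).
  by have := ij; rewrite leq_eqVlt => /orP[/eqP E|/(Trow r i' j')/ltnW//]; rewrite (_ : i' = j') //; apply: val_inj.
have sum_mu k : sumn (part_add be (part_scale k (aT T la))) = (sumn be + k * sumn la)%N.
  by rewrite (sumn_part_add (N := a)) ?size_part_scale ?sz_aT // sumn_part_scale sum_aT.
have sum_nu k : sumn (part_add ga (part_scale k (bT T la))) = (sumn ga + k * sumn la)%N.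
  by rewrite (sumn_part_add (N := b)) ?size_part_scale ?sz_bT // sumn_part_scale sum_bT.
have sum_la k : sumn (part_add al (part_scale k la)) = (sumn al + k * sumn la)%N.
  by rewrite (sumn_part_add (N := (a * b)%N)) ?size_part_scale // sumn_part_scale.
have [/andP[/eqP be_al /eqP ga_al]|mismatch] := boolP ((sumn be == sumn al) && (sumn ga == sumn al)).
  pose nl (p : 'I_(a * b)) := nth 0%N la p.
  have [|K HK] := @eventually_far R a b T x y xyT box boxK nl (fun p => nth 0%N al p) (vec a be, vec b ga).
    by move=> p q pq; apply: (strict_part_lt (N := (a * b)%N)) => //; rewrite pq ltn_ord.
  exists K => k Kk.
  have [|||||||||s s1|B B1B ->] := kron_count a0 b0 sT xyT TK boxK
     (n := sumn al + k * sumn la) (la := part_add al (part_scale k la))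
     (mu := part_add be (part_scale k (aT T la))) (nu := part_add ga (part_scale k (bT T la))) B1.
  - exact: sum_la.
  - by apply: sorted_part_add => //; apply: sorted_part_scale.
  - by rewrite size_part_add size_part_scale geq_max alN.
  - by rewrite sum_mu be_al.
  - by rewrite sum_nu ga_al.
  - by apply: sorted_part_add => //; apply: sorted_part_scale; apply: sorted_aT.
  - by apply: sorted_part_add => //; apply: sorted_part_scale; apply: sorted_bT.
  - by rewrite size_part_add size_part_scale sz_aT geq_max bea leqnn.
  - by rewrite size_part_add size_part_scale sz_bT geq_max gab leqnn.
  - have := HK k Kk s s1; rewrite (sum_boxes TK boxK).
    have -> : (vec a be, vec b ga) + (vec a (aT T la), vec b (bT T la)) *+ k =
        (vec a (part_add be (part_scale k (aT T la))), vec b (part_add ga (part_scale k (bT T la)))).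
      have pairMn (u : 'rV[int]_a) (v : 'rV[int]_b) : (u, v) *+ k = (u *+ k, v *+ k).
        by elim: k {Kk} => // k IH; rewrite !mulrS IH.
      by rewrite pairMn !vec_part_add.
    under [X in _ < _ X -> _]eq_bigr do rewrite -nth_part_scale -nth_part_add.
    by [].
  (* [aT T] and [bT T] are linear, so the multiples of [k] cancel and the polytope is the same for
     every [k]. *)
  have vec_aT m (F : seq nat -> seq nat) : (forall i : 'I_m, nth 0%N (F (part_add al (part_scale k la))) i =
      (nth 0%N (F al) i + k * nth 0%N (F la) i)%N) ->
      vec m (F (part_add al (part_scale k la))) = vec m (F al) + vec m (F la) *+ k.
    by move=> H; apply/rowP => i; rewrite !mxE mulmxnE mxE H PoszD PoszM -mulr_natl natz.
  rewrite !vec_part_add (vec_aT a (aT T)) => [|i]; last first.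
    by rewrite !nth_aT big_distrr -big_split; apply: eq_bigr => j _; rewrite nth_part_add nth_part_scale.
  rewrite (vec_aT b (bT T)) => [|j]; last first.
    by rewrite !nth_bT big_distrr -big_split; apply: eq_bigr => i _; rewrite nth_part_add nth_part_scale.
  have addrKr m (p q r : 'rV[int]_m) : p + r - (q + r) = p - q.
    by rewrite opprD addrACA subrr addr0.
  rewrite !addrKr.
  (* Both numbers count the same integral points: no solution has a coordinate reaching [B1], and
     [B1 <= B]. *)
  apply/card_eq_II; apply: card_eq_trans (card_integral_points R HB1).
  apply: card_esym; apply: card_integral_points => t tv i.
  exact: leq_trans (HB1 t tv i) B1B.
(* For different sizes [kron] is 0 for all [k]. A solution would force the coordinates of [mu0] and
   [nu0] to sum to 0, that is, the sizes to agree. *)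
exists 0%N => k _; rewrite /kron sum_mu sum_nu sum_la !eqn_add2r (negPf mismatch).
apply/esym/eqP; rewrite cards_eq0; apply/eqP/setP => t; rewrite !inE; apply/negP => /eqP tv.
case/negP: mismatch.
have wsum (i : 'I_(size (weights T))) : \sum_r (nth 0 (weights T) i).1 0 r = 0 /\ \sum_r (nth 0 (weights T) i).2 0 r = 0.
  apply: (@sum_coord_box_weights a b T); apply: (mem_box_weights a0 b0 sT).
  by rewrite mem_cat mem_nth ?orbT.
have coord0 m (F : 'I_(size (weights T)) -> 'rV[int]_m) : (forall i, \sum_r F i 0 r = 0) ->
    \sum_r (\sum_i F i *+ t i) 0 r = 0.
  move=> F0; under eq_bigr do rewrite summxE.
  rewrite exchange_big big1 // => i _.
  by under eq_bigr do rewrite mulmxnE; rewrite sumrMnl F0 mul0rn.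
have h1 : \sum_i mu0 0 i = 0.
  by rewrite -[mu0]/((mu0, nu0).1) -tv fst_sumMn coord0 // => i; case: (wsum i).
have h2 : \sum_j nu0 0 j = 0.
  by rewrite -[nu0]/((mu0, nu0).2) -tv snd_sumMn coord0 // => i; case: (wsum i).
have sum_vec m s s' : (size s <= m)%N -> (size s' <= m)%N ->
    \sum_(i < m) (vec m s - vec m s') 0 i = 0 -> sumn s = sumn s'.
  move=> sm sm'; under eq_bigr do rewrite !mxE.
  rewrite sumrB => /eqP; rewrite subr_eq0 -!(big_morph Posz PoszD (erefl _)) eqz_nat.
  by rewrite (part_sum (erefl (sumn s)) sm) (part_sum (erefl (sumn s')) sm') => /eqP.
by rewrite (sum_vec a _ _ _ _ h1) ?(sum_vec b _ _ _ _ h2) ?sz_aT ?sz_bT ?sum_aT ?sum_bT ?eqxx.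
Qed.
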